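(* Both HDG-Nash and HDG-IS are fixed-parameter tractable when parameterized by $\gamma+\sigma$.
   Context: A Hedonic diversity game consists of a set $N=[n]$ of agents partitioned into color classes $D_1,\dots,D_\gamma$, and, for each agent $i\in N$, a weak order $\succeq_i$ over palettes, where the palette of a nonempty set $X\subseteq N$ is the tuple $\left(|D_c\cap X|/|X|\right)_{c\in[\gamma]}$; agent $i$ compares nonempty sets $X,Y\subseteq N$ through their palettes, i.e. $X\succeq_i Y$ iff the palette of $X$ is weakly preferred by $i$ to the palette of $Y$. A coalition is a nonempty subset of $N$; it is trivial if it has size $1$. An outcome is a partition $\Pi$ of $N$ into coalitions; $\Pi_i$ denotes the coalition of $\Pi$ containing agent $i$. Agent $i$ has an NS-deviation if there is $C\in\Pi\cup\{\emptyset\}$ with $i\notin C$ and $C\cup\{i\}\succ_i\Pi_i$; it is an IS-deviation if moreover $C\cup\{i\}\succeq_j C$ for every $j\in C$. $\Pi$ is Nash stable if no agent has an NS-deviation, and individually stable if no agent has an IS-deviation. The number of agent types $\tau$ is the number of distinct weak orders among $\{\succeq_i : i\in N\}$. HDG-Nash (resp. HDG-IS) is the problem: given such a game, where preferences are accessed via an oracle answering in constant time whether $X\succeq_i Y$ for given $i,X,Y$, together with integers $\sigma,\rho_{\geq1},\rho_{\geq2}$, decide whether there is a Nash stable (resp. individually stable) outcome with at most $\rho_{\geq1}$ coalitions in total, at most $\rho_{\geq2}$ non-trivial coalitions, and every coalition of size at most $\sigma$. The parameters considered are $\gamma$ (number of colors), $\sigma$, $\rho_{\geq1}$, $\rho_{\geq2}$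 and $\tau$. FPT, XP, W[1]-hardness and NP-hardness are meant in the standard (parameterized) complexity sense, with $n$ as the input size. *)

(* Defs.v *)
From mathcomp Require Import all_boot all_order all_algebra.
Set Implicit Arguments. Unset Strict Implicit. Unset Printing Implicit Defensive.
Import GRing.Theory Num.Theory.

(* Agents are 'I_n, colours are 'I_gam; col i is the colour of agent i.  *)

Definition palette_t (gam : nat) := {ffun 'I_gam -> rat}.

Definition palette n gam (col : 'I_n -> 'I_gam) (X : {set 'I_n}) : palette_t gam :=
  [ffun c => (#|[set x in X | col x == c]|%:R / #|X|%:R)%R].

(* pref i P Q  means  palette P is weakly preferred by i to palette Q *)
Definition weakly_pref n gam (col : 'I_n -> 'I_gam)
  (pref : 'I_n -> rel (palette_t gam)) (i : 'I_n) (X Y : {set 'I_n}) : bool :=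
  pref i (palette col X) (palette col Y).

Definition strictly_pref n gam (col : 'I_n -> 'I_gam)
  (pref : 'I_n -> rel (palette_t gam)) (i : 'I_n) (X Y : {set 'I_n}) : bool :=
  weakly_pref col pref i X Y && ~~ weakly_pref col pref i Y X.

Definition valid_game n gam (col : 'I_n -> 'I_gam)
  (pref : 'I_n -> rel (palette_t gam)) : Prop :=
  (forall c : 'I_gam, exists i : 'I_n, col i = c) /\
  (forall (i : 'I_n) (X Y : {set 'I_n}), X != set0 -> Y != set0 ->
      weakly_pref col pref i X Y || weakly_pref col pref i Y X) /\
  (forall (i : 'I_n) (X Y Z : {set 'I_n}), X != set0 -> Y != set0 -> Z != set0 ->
      weakly_pref col pref i X Y -> weakly_pref col pref i Y Z ->
      weakly_pref col pref i X Z).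

Definition NS_deviation n gam (col : 'I_n -> 'I_gam)
  (pref : 'I_n -> rel (palette_t gam)) (Pi : {set {set 'I_n}}) (i : 'I_n)
  (C : {set 'I_n}) : Prop :=
  (C \in Pi \/ C = set0) /\ i \notin C /\
  strictly_pref col pref i (C :|: [set i]) (pblock Pi i).

Definition IS_deviation n gam (col : 'I_n -> 'I_gam)
  (pref : 'I_n -> rel (palette_t gam)) (Pi : {set {set 'I_n}}) (i : 'I_n)
  (C : {set 'I_n}) : Prop :=
  NS_deviation col pref Pi i C /\
  (forall j, j \in C -> weakly_pref col pref j (C :|: [set i]) C).

Definition nash_stable n gam (col : 'I_n -> 'I_gam)
  (pref : 'I_n -> rel (palette_t gam)) (Pi : {set {set 'I_n}}) : Prop :=
  forall i C, ~ NS_deviation col pref Pi i C.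

Definition indiv_stable n gam (col : 'I_n -> 'I_gam)
  (pref : 'I_n -> rel (palette_t gam)) (Pi : {set {set 'I_n}}) : Prop :=
  forall i C, ~ IS_deviation col pref Pi i C.

Definition stability_notion :=
  forall n gam, ('I_n -> 'I_gam) -> ('I_n -> rel (palette_t gam)) ->
    {set {set 'I_n}} -> Prop.

Definition hdg_yes (stable : stability_notion) n gam (col : 'I_n -> 'I_gam)
  (pref : 'I_n -> rel (palette_t gam)) (sigma rho1 rho2 : nat) : Prop :=
  exists Pi : {set {set 'I_n}},
    partition Pi [set: 'I_n] /\
    (#|Pi| <= rho1)%N /\
    (#|[set C in Pi | (2 <= #|C|)%N]| <= rho2)%N /\
    (forall C, C \in Pi -> (#|C| <= sigma)%N) /\
    stable n gam col pref Pi.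

(* Machine model: unit-cost RAM (natural-number memory, + and truncated *)
(* -, indirect addressing) with a constant-time preference oracle.       *)

Inductive instr : Type :=
| IConst of nat & nat
| IAdd of nat & nat & nat
| ISub of nat & nat & nat
| ILoad of nat & nat
| IStore of nat & nat
| IJz of nat & nat
| IQuery of nat.

Definition program := seq instr.
Definition config := (nat * (nat -> nat))%type.
(* oracle: agent, list of members of X, list of members of Y *)
Definition oracle := nat -> seq nat -> seq nat -> bool.

Definition upd (m : nat -> nat) (a v : nat) : nat -> nat :=
  fun x => if x == a then v else m x.

Definition read_seq (m : nat -> nat) (start len : nat) : seq nat :=
  [seq m (start + k) | k <- iota 0 len].

Definition step (P : program) (O : oracle) (cfg : config) : config :=
  let: (pc, m) := cfg in
  if (size P <= pc)%N then cfg else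
  match nth (IJz 0 0) P pc with
  | IConst a k => (pc.+1, upd m a k)
  | IAdd a b c => (pc.+1, upd m a (m b + m c))
  | ISub a b c => (pc.+1, upd m a (m b - m c))
  | ILoad a b => (pc.+1, upd m a (m (m b)))
  | IStore a b => (pc.+1, upd m (m a) (m b))
  | IJz a l => (if m a == 0 then l else pc.+1, m)
  | IQuery r =>
      (pc.+1, upd m r (nat_of_bool
         (O (m r) (read_seq m (m (r + 1)) (m (r + 2)))
                  (read_seq m (m (r + 3)) (m (r + 4))))))
  end.

Definition run (P : program) (O : oracle) (c : config) (t : nat) : config :=
  iter t (step P O) c.

Definition halted (P : program) (c : config) : bool := (size P <= c.1)%N.

Definition set_of n (xs : seq nat) : {set 'I_n} := [set x : 'I_n | val x \in xs].

Definition game_oracle n gam (col : 'I_n -> 'I_gam)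
  (pref : 'I_n -> rel (palette_t gam)) : oracle :=
  fun i xs ys =>
    match insub i : option 'I_n with
    | Some i' => weakly_pref col pref i' (set_of n xs) (set_of n ys)
    | None => false
    end.

Definition col_nat n gam (col : 'I_n -> 'I_gam) (k : nat) : nat :=
  match insub k : option 'I_n with Some i => val (col i) | None => 0 end.

Definition init_mem n gam (col : 'I_n -> 'I_gam) (sigma rho1 rho2 : nat) : nat -> nat :=
  fun a =>
    if a == 0 then n else if a == 1 then gam else if a == 2 then sigma
    else if a == 3 then rho1 else if a == 4 then rho2
    else if (5 <= a < 5 + n)%N then col_nat col (a - 5) else 0.

Definition no_oracle : oracle := fun _ _ _ => false.

Definition ram_computable (f : nat -> nat) : Prop :=
  exists P : program, forall k, exists t,
    let c := run P no_oracle (0, upd (fun _ => 0) 0 k) t in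
    halted P c /\ c.2 0 = f k.

Definition fpt_gamma_sigma (stable : stability_notion) : Prop :=
  exists (P : program) (f : nat -> nat) (c : nat),
    ram_computable f /\
    forall n gam (col : 'I_n -> 'I_gam) (pref : 'I_n -> rel (palette_t gam))
           (sigma rho1 rho2 : nat),
      valid_game col pref ->
      let cfg := run P (game_oracle col pref)
                   (0, init_mem col sigma rho1 rho2) (f (gam + sigma) * (n + 1) ^ c) in
      halted P cfg /\ (cfg.2 0 != 0 <-> hdg_yes stable col pref sigma rho1 rho2).

(* Main.v *)
(* Only palettes of coalitions with at most sigma + 1 members matter, and there are
   boundedly many of them, so agents fall into boundedly many types (colour plus
   preference restricted to these palettes) and coalitions of size at most sigma into
   boundedly many kinds.  Whether an outcome is stable depends only on which kinds occur,
   and which of them occur at least twice.  So one guesses, for each kind, its multiplicity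
   capped at 2, checks stability, and asks whether the multiplicities can be completed
   to a nonnegative integer solution of the linear system saying that every agent is used
   once and that the numbers of coalitions are as guessed.  Its left-hand side has boundedly
   many bounded coefficients, so adding up binary digits from the lowest one, only boundedly
   many vectors of carries can occur, and a dynamic programme over the bits of the
   right-hand side decides solvability.

   For the running time, arithmetic expressions with bounded loops are compiled to the RAM
   by closure lemmas which track that values and times are at most a tower of twos
   of height gamma + sigma + O(1), times a power of n where allowed. *)
Require Import Defs.
From mathcomp Require Import all_boot all_order all_algebra.
From mathcomp Require Import zify.
Set Implicit Arguments. Unset Strict Implicit. Unset Printing Implicit Defensive.

(** * A calculus of RAM programs *)

(** The cap 2 suffices because a second copy of a kind matters only when an agent wants to move to
    another coalition of the same kind as its own. The empty set, always a possible target, has code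
    0 and a zero column in the linear system, so it can be declared present at no cost. Preferences
    are reachable only through queries on lists of agents. Each vector of colour counts is therefore
    queried through a concrete set, made of the first agents of each colour. The right-hand sides
    grow with [n], so they cannot be enumerated within the state of a dynamic programme; the carries
    can, as their range depends on the coefficients only. The machine merely adds and subtracts:
    products, quotients and powers are loops whose duration depends on the values, so values and
    times are tracked together, and a number like [2 ^ k] with [k] up to [n] must never be formed.
    Towers are used as bounds because products and powers only add a constant to the height, which
    spares any explicit estimate of the nested exponentials, and because the tower function is
    itself easily computed on the RAM. *)

Lemma updE m a v x : upd m a v x = if x == a then v else m x.
Proof. by []. Qed.

Lemma upd_eq m a v : upd m a v a = v.
Proof. by rewrite updE eqxx. Qed.

Lemma upd_at m a v x : x = a -> upd m a v x = v.
Proof. by move=> ->; apply: upd_eq. Qed.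

Lemma upd_neq m a v x : x != a -> upd m a v x = m x.
Proof. by rewrite updE => /negPf ->. Qed.

Definition fetch (P : program) p i := p < size P /\ nth (IJz 0 0) P p = i.

(** Jumps are absolute, so a fragment is always considered together with the address [p] at which it
    sits in the whole program. *)
Fixpoint placed (P : program) p (c : program) : Prop :=
  if c is i :: c' then fetch P p i /\ placed P p.+1 c' else True.

Lemma placed_cat P p c1 c2 :
  placed P p (c1 ++ c2) <-> placed P p c1 /\ placed P (p + size c1) c2.
Proof.
elim: c1 p => [|i c1 IH] p /=; first by rewrite addn0; tauto.
by rewrite IH addnS addSn; tauto.
Qed.

Lemma placed_mid A c B : placed (A ++ c ++ B) (size A) c.
Proof.
elim: c A => [|i c IH] A //=; split.
  by rewrite /fetch size_cat /= nth_cat ltnn subnn; split => //; lia.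
by have := IH (rcons A i); rewrite size_rcons cat_rcons.
Qed.

Section Execution.
Variables (P : program) (O : oracle).

(** A total-correctness triple with a time bound. An upper bound [B] on the number of steps is
    enough, since a halted configuration no longer changes. *)
Definition wp p m q B (Q : (nat -> nat) -> Prop) :=
  exists m', (exists2 T, T <= B & run P O (p, m) T = (q, m')) /\ Q m'.

Lemma wp_le p m q B1 B2 Q : wp p m q B1 Q -> B1 <= B2 -> wp p m q B2 Q.
Proof.
move=> [m' [[T hT hr] hQ]] hB; exists m'; split=> //; exists T => //.
exact: leq_trans hB.
Qed.

Lemma wp_done p m q (Q : (nat -> nat) -> Prop) : Q m -> p = q -> wp p m q 0 Q.
Proof. by move=> hQ <-; exists m; split=> //; exists 0. Qed.

Lemma wp_seq p m p1 q B1 B2 (Q1 Q : (nat -> nat) -> Prop) :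
  wp p m p1 B1 Q1 -> (forall m', Q1 m' -> wp p1 m' q B2 Q) ->
  wp p m q (B1 + B2) Q.
Proof.
move=> [m1 [[T1 h1 r1] /[swap]]] /[apply] -[m2 [[T2 h2 r2] hQ]].
exists m2; split=> //; exists (T2 + T1); first by rewrite addnC leq_add.
by rewrite /run iterD; move: r1; rewrite /run => ->.
Qed.

Lemma wp_step p m p1 m1 q B Q :
  step P O (p, m) = (p1, m1) -> wp p1 m1 q B Q -> wp p m q B.+1 Q.
Proof.
move=> h1 [m' [[T hT hr] hQ]]; exists m'; split=> //; exists T.+1 => //.
by rewrite /run iterSr h1.
Qed.

Lemma stepE p m i : fetch P p i -> step P O (p, m) =
  match i with
  | IConst a k => (p.+1, upd m a k)
  | IAdd a b c => (p.+1, upd m a (m b + m c))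
  | ISub a b c => (p.+1, upd m a (m b - m c))
  | ILoad a b => (p.+1, upd m a (m (m b)))
  | IStore a b => (p.+1, upd m (m a) (m b))
  | IJz a l => (if m a == 0 then l else p.+1, m)
  | IQuery r => (p.+1, upd m r (nat_of_bool
         (O (m r) (read_seq m (m (r + 1)) (m (r + 2)))
                  (read_seq m (m (r + 3)) (m (r + 4))))))
  end.
Proof. by move=> [h1 h2]; rewrite /step leqNgt h1 /= h2; case: i {h2}. Qed.

Lemma wp_const p m a k q B Q : fetch P p (IConst a k) ->
  wp p.+1 (upd m a k) q B Q -> wp p m q B.+1 Q.
Proof. by move=> /stepE h; apply: wp_step; rewrite h. Qed.

Lemma wp_add p m a b c q B Q : fetch P p (IAdd a b c) ->
  wp p.+1 (upd m a (m b + m c)) q B Q -> wp p m q B.+1 Q.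
Proof. by move=> /stepE h; apply: wp_step; rewrite h. Qed.

Lemma wp_sub p m a b c q B Q : fetch P p (ISub a b c) ->
  wp p.+1 (upd m a (m b - m c)) q B Q -> wp p m q B.+1 Q.
Proof. by move=> /stepE h; apply: wp_step; rewrite h. Qed.

Lemma wp_load p m a b q B Q : fetch P p (ILoad a b) ->
  wp p.+1 (upd m a (m (m b))) q B Q -> wp p m q B.+1 Q.
Proof. by move=> /stepE h; apply: wp_step; rewrite h. Qed.

Lemma wp_store p m a b q B Q : fetch P p (IStore a b) ->
  wp p.+1 (upd m (m a) (m b)) q B Q -> wp p m q B.+1 Q.
Proof. by move=> /stepE h; apply: wp_step; rewrite h. Qed.

Lemma wp_jz0 p m a l q B Q : fetch P p (IJz a l) -> m a = 0 ->
  wp l m q B Q -> wp p m q B.+1 Q.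
Proof. by move=> /stepE h h0; apply: wp_step; rewrite h h0. Qed.

Lemma wp_jzS p m a l q B Q : fetch P p (IJz a l) -> m a != 0 ->
  wp p.+1 m q B Q -> wp p m q B.+1 Q.
Proof. by move=> /stepE h /negPf h0; apply: wp_step; rewrite h h0. Qed.

Lemma wp_query p m r q B Q : fetch P p (IQuery r) ->
  wp p.+1 (upd m r (nat_of_bool
         (O (m r) (read_seq m (m (r + 1)) (m (r + 2)))
                  (read_seq m (m (r + 3)) (m (r + 4)))))) q B Q ->
  wp p m q B.+1 Q.
Proof. by move=> /stepE h; apply: wp_step; rewrite h. Qed.

End Execution.

(** * Instances and their growth bounds *)

Record inst := Inst
  { nn : nat; gm : nat; sg : nat; rh1 : nat; rh2 : nat; cl : nat -> nat; orc : oracle }.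

Fixpoint tw x := if x is y.+1 then 2 ^ tw y else 1.

(* The two growth classes: [true] for quantities that depend on the parameter
   only, [false] for those that may also be polynomial in [n]. *)
Definition bnd (b : bool) c I :=
  tw (gm I + sg I + c) * (if b then 1 else (nn I).+1 ^ c).

Lemma tw_gt0 x : 0 < tw x.
Proof. by case: x => //= x; rewrite expn_gt0. Qed.

Lemma tw_gtn x : x < tw x.
Proof. elim: x => //= x IH; exact: leq_trans (ltn_expl _ _). Qed.

Lemma leq_tw x y : x <= y -> tw x <= tw y.
Proof.
move/subnKC <-; elim: (y - x) => [|d IH]; first by rewrite addn0.
by rewrite addnS /=; apply: leq_trans IH _; apply: ltnW; apply: ltn_expl.
Qed.

(** The reason why a product costs two levels of the tower: it is at most [2 ^ (2 * z)], and
    [2 * z <= 2 ^ z]. *)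
Lemma muln_leq_exp2 x y z : x <= z -> y <= z -> x * y <= 2 ^ (2 ^ z).
Proof.
move=> hx hy; apply: (@leq_trans (2 ^ z * 2 ^ z)).
  by apply: leq_mul; apply: ltnW; [apply: leq_ltn_trans hx _|apply: leq_ltn_trans hy _];
    apply: ltn_expl.
rewrite -expnD leq_exp2l // addnn -mul2n.
case: z {hx hy} => // z; rewrite expnS leq_pmul2l //; exact: ltn_expl.
Qed.

Lemma bnd_leq b c c' I : c <= c' -> bnd b c I <= bnd b c' I.
Proof.
move=> h; apply: leq_mul; first by apply: leq_tw; rewrite leq_add2l.
by case: b => //; rewrite leq_pexp2l.
Qed.

Lemma bnd_gt c b I : c < bnd b c I.
Proof.
apply: (@leq_trans (tw (gm I + sg I + c))).
  by apply: leq_trans (tw_gtn _); rewrite ltnS leq_addl.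
by rewrite leq_pmulr //; case: b => //; rewrite expn_gt0.
Qed.

Lemma bnd_gt0 c b I : 0 < bnd b c I.
Proof. exact: leq_ltn_trans (bnd_gt c b I). Qed.

Lemma bnd_mul b c c' I : bnd b c I * bnd b c' I <= bnd b (c + c').+2 I.
Proof.
rewrite /bnd mulnACA; apply: leq_mul; last first.
  by case: b => //; rewrite -expnD leq_pexp2l //; lia.
rewrite !addnS /=; apply: muln_leq_exp2; apply: leq_tw; lia.
Qed.

Lemma bnd_false b c I : bnd b c I <= bnd false c I.
Proof. by case: b => //; rewrite /bnd muln1 leq_pmulr // expn_gt0. Qed.

Lemma bnd_true b c I : bnd true c I <= bnd b c I.
Proof. by case: b => //; apply: bnd_false. Qed.

Definition dom b (g : inst -> nat) := exists c, forall I, g I <= bnd b c I.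

Lemma dom_bnd b c : dom b (bnd b c). Proof. by exists c. Qed.

Lemma dom_bndT b c : dom b (bnd true c).
Proof. by exists c => I; apply: bnd_true. Qed.

Lemma dom_bndF b c : dom false (bnd b c).
Proof. by exists c => I; apply: bnd_false. Qed.

Lemma dom_cst b x : dom b (fun=> x).
Proof. by exists x => I; apply: ltnW; apply: bnd_gt. Qed.

Lemma dom_mul b f g : dom b f -> dom b g -> dom b (fun I => f I * g I).
Proof.
move=> [c hf] [c' hg]; exists (c + c').+2 => I.
by apply: leq_trans (bnd_mul _ _ _ _); apply: leq_mul.
Qed.

Lemma dom_le b f g : (forall I, f I <= g I) -> dom b g -> dom b f.
Proof. by move=> h [c hg]; exists c => I; apply: leq_trans (hg I). Qed.

(** Both bounds are positive, so their sum is at most twice their product. *)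
Lemma dom_add b f g : dom b f -> dom b g -> dom b (fun I => f I + g I).
Proof.
move=> [c hf] [c' hg].
apply: (@dom_le _ _ (fun I => 2 * (bnd b c I * bnd b c' I))) => [I|].
  have := hf I; have := hg I; have := bnd_gt0 c b I; have := bnd_gt0 c' b I; nia.
by apply: dom_mul (dom_cst _ _) (dom_mul (dom_bnd _ _) (dom_bnd _ _)).
Qed.

Lemma dom_S b f : dom b f -> dom b (fun I => (f I).+1).
Proof. by move=> h; apply: dom_le (dom_add h (dom_cst b 1)) => I; rewrite addn1. Qed.

(** As [f < 2 ^ f], the power is at most [2 ^ (f * g)], one level above the product. Functions
    polynomial in [n] are not closed under powers, whence the class [true]. *)
Lemma dom_pow f g : dom true f -> dom true g -> dom true (fun I => f I ^ g I).
Proof.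
move=> hf hg; have [c hc] := dom_mul hf hg; exists c.+1 => I.
have {}hc : f I * g I <= tw (gm I + sg I + c) by move: (hc I); rewrite /bnd muln1.
rewrite /bnd muln1 addnS /=.
apply: leq_trans (_ : 2 ^ (f I * g I) <= _); last by rewrite leq_exp2l.
rewrite expnM; case: (g I) => [|x]; first by rewrite !expn0.
by rewrite leq_exp2r // ltnW // ltn_expl.
Qed.

Ltac dom := repeat first [assumption | exact: dom_bnd | exact: dom_bndT | exact: dom_bndF
  | exact: dom_cst | apply: dom_add | apply: dom_mul | apply: dom_S | apply: dom_pow].

(** * Environments, and expressions over them that compile to the machine *)

Definition ctx := seq bool.

Fixpoint env (G : ctx) : Type := if G is _ :: G' then (env G' * nat)%type else inst.

Fixpoint ins G : env G -> inst :=
  match G with [::] => fun e => e | _ :: G' => fun e => ins e.1 end.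

Definition wfI I := (forall j, cl I j <= gm I) /\ (forall j, nn I <= j -> cl I j = 0).

Fixpoint wf G c : env G -> Prop :=
  match G with
  | [::] => fun e => wfI e
  | b :: G' => fun e => wf c e.1 /\ e.2 <= bnd b c (ins e.1)
  end.

Fixpoint rep G (av : seq nat) (m : nat -> nat) : env G -> Prop :=
  match G with
  | [::] => fun e => True
  | b :: G' => fun e => m (head 0 av) = e.2 /\ @rep G' (behead av) m e.1
  end.

(* Registers 0 to 4 hold the input, 5 the address of the colour array and 6 the top
   of a stack of query arguments; registers below [W] are the code's to use. *)
Definition inv W I (m : nat -> nat) :=
  [/\ m 0 = nn I, m 1 = gm I, m 2 = sg I, m 3 = rh1 I & m 4 = rh2 I] /\
  [/\ W <= m 5, m 5 + nn I < m 6 & forall j, j <= nn I -> m (m 5 + j) = cl I j].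

(** The second clause protects the colour array and what is already on the query stack, so that
    expressions containing queries can be nested. *)
Definition agree t W (m m' : nat -> nat) :=
  (forall a, a < t -> m' a = m a) /\ (forall a, W <= a -> a < m 6 -> m' a = m a).

(** The level [c] is quantified outside because a loop body is instantiated only once the bounds on
    its index and accumulator are known. *)
Definition BD G b (F : env G -> nat) :=
  forall c, exists c', forall e, wf c e -> F e <= bnd b c' (ins e).

Definition good G (av : seq nat) t := all (fun a => 6 < a < t) av /\ size av = size (G : ctx).

(* [code av p t], placed at [p], evaluates [F] into register [t]; [av] lists the
   registers holding the variables, registers in [t, W) are scratch space. *)
Definition computes G (F : env G -> nat) (code : seq nat -> nat -> nat -> program) w c c' :=
  forall e, wf c e ->
  forall P av p t m W, placed P p (code av p t) -> inv W (ins e) m -> 6 < t ->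
    t + w <= W -> good G av t -> rep av m e ->
    wp P (orc (ins e)) p m (p + size (code av p t)) (bnd false c' (ins e))
      (fun m' => m' t = F e /\ agree t W m m').

Definition CP G (F : env G -> nat) :=
  exists code w, forall c, exists c', computes F code w c c'.

Definition FP G b (F : env G -> nat) := BD b F /\ CP F.

Lemma agree_trans t t' W m m' m'' : 6 < t -> t <= t' ->
  agree t W m m' -> agree t' W m' m'' -> agree t W m m''.
Proof.
move=> h6 ht [h1 h2] [h1' h2']; split=> a ha.
  by rewrite h1' ?h1 //; exact: leq_trans ha ht.
by move=> hb; rewrite h2' ?(h1 6) // h2.
Qed.

Lemma agree_upd t W m m' a v : t <= a -> a < W -> agree t W m m' ->
  agree t W m (upd m' a v).
Proof.
move=> h1 h2 [h3 h4]; split=> x hx; first by rewrite upd_neq ?h3 //; lia.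
by move=> hx2; rewrite upd_neq ?h4 //; lia.
Qed.

Lemma agree_inv t W I m m' : 6 < t -> t <= W -> agree t W m m' -> inv W I m -> inv W I m'.
Proof.
move=> h6 hW [h1 h2] [[e0 e1 e2 e3 e4] [e5 e6 e7]].
have e a : a < 7 -> m' a = m a by move=> ha; apply: h1; lia.
rewrite /inv !e //; do !split=> //.
by move=> j hj; rewrite h2 ?e7 //; lia.
Qed.

Lemma rep_ext t m m' G (e : env G) av : good G av t ->
  (forall a, 6 < a < t -> m' a = m a) -> rep av m e -> rep av m' e.
Proof.
move=> [hg hs] h1; elim: G e av hg hs => [|b G IH] //= [e x] [|a av] //= /andP[ha hav] [hs].
by move=> [h h']; split; [rewrite h1|apply: IH].
Qed.

Lemma agree_rep t W m m' G (e : env G) av : good G av t -> agree t W m m' ->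
  rep av m e -> rep av m' e.
Proof. by move=> hg [h _]; apply: rep_ext hg _ => a /andP[_ /h]. Qed.

Lemma wf_le G c c' (e : env G) : wf c e -> c <= c' -> wf c' e.
Proof.
move=> he hc; elim: G e he => [|b G IH] //= e [h1 h2]; split; auto.
exact: leq_trans h2 (bnd_leq _ _ hc).
Qed.

Lemma wf_ins G c (e : env G) : wf c e -> wfI (ins e).
Proof. by elim: G e => //= b G IH e [/IH]. Qed.

Lemma good_le G av t t' : good G av t -> t <= t' -> good G av t'.
Proof.
by move=> [h1 h2] h; split=> //; apply: sub_all h1 => a /andP[-> ha]; apply: leq_trans h.
Qed.

Lemma BD_dom G b (F : env G -> nat) (g : nat -> inst -> nat) :
  (forall c e, wf c e -> F e <= g c (ins e)) -> (forall c, dom b (g c)) -> BD b F.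
Proof.
move=> h hd c; have [c' h'] := hd c; exists c' => e he.
exact: leq_trans (h _ _ he) (h' _).
Qed.

Lemma BD_op2 G b1 b2 b (op : nat -> nat -> nat) (F1 F2 : env G -> nat) :
  (forall x y x' y', x <= x' -> y <= y' -> op x y <= op x' y') ->
  (forall c1 c2, dom b (fun I => op (bnd b1 c1 I) (bnd b2 c2 I))) ->
  BD b1 F1 -> BD b2 F2 -> BD b (fun e => op (F1 e) (F2 e)).
Proof.
move=> hm hd h1 h2 c; have [c1 {}h1] := h1 c; have [c2 {}h2] := h2 c.
have [c' h] := hd c1 c2; exists c' => e he.
by apply: leq_trans (h _); apply: hm; auto.
Qed.

Lemma BD_le G b (F F' : env G -> nat) :
  (forall c e, wf c e -> F e <= F' e) -> BD b F' -> BD b F.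
Proof.
move=> h hb c; have [c' h'] := hb c; exists c' => e he.
exact: leq_trans (h _ _ he) (h' _ he).
Qed.

Lemma BD_add G b (F1 F2 : env G -> nat) : BD b F1 -> BD b F2 -> BD b (fun e => F1 e + F2 e).
Proof. by move=> h1 h2; apply: (@BD_op2 _ b b b addn) h1 h2 => *; [exact: leq_add|dom]. Qed.

Lemma BD_cst G b x : BD b (fun _ : env G => x).
Proof. by apply: (@BD_dom _ _ _ (fun _ _ => x)) => *; dom. Qed.

Lemma BD_bool G b (F : env G -> bool) : BD b (fun e => F e : nat).
Proof. by apply: (@BD_dom _ _ _ (fun _ _ => 1)) => *; [case: (F _)|dom]. Qed.

Lemma BD_weak G b (F : env G -> nat) : BD true F -> BD b F.
Proof. by move=> h c; have [c' h'] := h c; exists c' => e /h' /leq_trans; apply; apply: bnd_true. Qed.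

Lemma BD_false G b (F : env G -> nat) : BD b F -> BD false F.
Proof. by move=> h c; have [c' h'] := h c; exists c' => e /h' /leq_trans; apply; apply: bnd_false. Qed.

Lemma BD_pow G (F1 F2 : env G -> nat) : BD true F1 -> BD true F2 ->
  BD true (fun e => F1 e ^ F2 e).
Proof.
move=> h1 h2; apply: (@BD_le _ _ _ (fun e => (F1 e).+1 ^ F2 e)) => [c e _|].
  by case: (F2 e) => // x; rewrite leq_exp2r.
apply: (@BD_op2 _ true true true (fun x y => x.+1 ^ y)) h1 h2 => [x y x' y' hx hy|*]; last by dom.
by apply: leq_trans (_ : x'.+1 ^ y <= _); [case: y {hy} => // y; rewrite leq_exp2r|rewrite leq_pexp2l].
Qed.

Lemma CP_ext G (F F' : env G -> nat) : (forall c e, wf c e -> F e = F' e) -> CP F -> CP F'.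
Proof.
move=> h [code [w hC]]; exists code, w => c; have [c' {}hC] := hC c; exists c' => e he *.
by rewrite -(h _ _ he); apply: hC.
Qed.

Lemma FP_ext G b (F F' : env G -> nat) :
  (forall c e, wf c e -> F e = F' e) -> FP b F -> FP b F'.
Proof.
move=> h [h1 h2]; split; last exact: CP_ext h2.
by apply: BD_le h1 => c e /h ->.
Qed.

Lemma FP_weak G b (F : env G -> nat) : FP true F -> FP b F.
Proof. by case=> h1 h2; split=> //; apply: BD_weak. Qed.

Lemma FP_false G b (F : env G -> nat) : FP b F -> FP false F.
Proof. by case=> h1 h2; split=> //; apply: BD_false h1. Qed.

(** A truth value obeys every growth class, however large the numbers behind it. This is how tests
    on quantities of size [n] return to the class of parameter-bounded values. *)
Lemma FP_bool G b (F : env G -> bool) : CP (fun e => F e : nat) -> FP b (fun e => F e : nat).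
Proof. by split=> //; apply: BD_bool. Qed.

Lemma BD_var G b : BD b (fun e : env (b :: G) => e.2).
Proof. by move=> c; exists c => e []. Qed.

Lemma BD_wk G b b' (F : env G -> nat) : BD b F -> BD b (fun e : env (b' :: G) => F e.1).
Proof. by move=> h c; have [c' {}h] := h c; exists c' => e [/h]. Qed.

Lemma CP_wk G b' (F : env G -> nat) : CP F -> CP (fun e : env (b' :: G) => F e.1).
Proof.
move=> [code [w hC]]; exists (fun av => code (behead av)), w => c.
have [c' {}hC] := hC c; exists c' => -[e x] [/= he hx] P [|a av] p t m W.
  by move=> ? ? ? ? [].
move=> /= hp hi ht hw [/= /andP[ha hav] [hs]] [h1 h2].
exact: hC.
Qed.

Lemma FP_wk G b b' (F : env G -> nat) : FP b F -> FP b (fun e : env (b' :: G) => F e.1).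
Proof. by case=> h1 h2; split; [apply: BD_wk|apply: CP_wk]. Qed.

(* A straight-line fragment over at most [w] registers that costs [T] steps. *)
Lemma CP_line G (F : env G -> nat) (code : seq nat -> nat -> program) w T :
  (forall c e, wf c e -> forall P av p t m W, placed P p (code av t) ->
    inv W (ins e) m -> 6 < t -> t + w <= W -> good G av t -> rep av m e ->
    wp P (orc (ins e)) p m (p + size (code av t)) T
      (fun m' => m' t = F e /\ agree t W m m')) -> CP F.
Proof.
move=> h; exists (fun av _ => code av), w => c; exists T => e he *.
by apply: wp_le (ltnW (bnd_gt _ _ _)); eapply h; eauto.
Qed.

Ltac ups := repeat first [rewrite upd_eq | rewrite upd_neq; last by lia
  | rewrite upd_at; last by lia].

Lemma CP_cst G x : CP (fun _ : env G => x).
Proof.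
apply: (@CP_line _ _ (fun _ t => [:: IConst t x]) 1 1) => c e he P av p t m W /= [hp _] hi ht hw _ _.
apply: (wp_const hp); apply: wp_done; last lia.
by rewrite upd_eq; split=> //; apply: agree_upd => //; lia.
Qed.

Lemma CP_glob G (F : env G -> nat) a :
  (forall e W m, inv W (ins e) m -> m a = F e) -> a < 7 -> CP F.
Proof.
move=> hF ha; apply: (@CP_line _ _ (fun _ t => [:: IConst t.+1 0; IAdd t a t.+1]) 2 2).
move=> c e he P av p t m W /= [h1 [h2 _]] hi ht hw _ _.
apply: (wp_const h1); apply: (wp_add h2); apply: wp_done; last lia.
split; first by ups; rewrite addn0; exact: hF hi.
by do !apply: agree_upd => //; lia.
Qed.

Lemma CP_var G b : CP (fun e : env (b :: G) => e.2).
Proof.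
apply: (@CP_line _ _ (fun av t => [:: IConst t.+1 0; IAdd t (head 0 av) t.+1]) 2 2).
move=> c [e x] he P [|a av] p t m W /= [h1 [h2 _]] hi ht hw [//= hg _] [ha _] //.
apply: (wp_const h1); apply: (wp_add h2); apply: wp_done; last lia.
split; first by ups; rewrite addn0.
by do !apply: agree_upd => //; lia.
Qed.

(* Indices beyond [n] are truncated to [n], where the colour array holds a 0. *)
Lemma CP_col G (F : env G -> nat) : CP F -> CP (fun e => cl (ins e) (F e)).
Proof.
move=> [code [w hC]].
exists (fun av p t => code av p t ++
  [:: ISub t.+1 t 0; ISub t t t.+1; IAdd t t 5; ILoad t t]), w.+2 => c.
have [c' {}hC] := hC c.
have [c'' hd] : dom false (fun I => bnd false c' I + 4) by dom.
exists c'' => e he P av p t m W /placed_cat [hp] /= [h1 [h2 [h3 [h4 _]]]] hi ht hw hg hr.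
apply: (wp_le _ (hd _)); rewrite size_cat /=.
apply: wp_seq; first by apply: (hC e he P av p t m W) => //; lia.
move=> m' [e1 e2].
have [[i0 i1 i2 i3 i4] [i5 i6 i7]] : inv W (ins e) m' by apply: agree_inv e2 hi => //; lia.
apply: (wp_sub h1); apply: (wp_sub h2); apply: (wp_add h3); apply: (wp_load h4).
apply: wp_done; last lia.
split; last by do !apply: agree_upd => //; lia.
have e5 m1 a v : 6 < a -> upd m1 a v 5 = m1 5 by move=> ?; rewrite upd_neq //; lia.
have e0 m1 a v : 6 < a -> upd m1 a v 0 = m1 0 by move=> ?; rewrite upd_neq //; lia.
rewrite !upd_eq !e5 ?e0 ?upd_neq; try lia.
rewrite e1 i0.
case: (leqP (F e) (nn (ins e))) => hn.
  have -> : F e - (F e - nn (ins e)) + m' 5 = m' 5 + F e by lia.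
  by rewrite i7.
have -> : F e - (F e - nn (ins e)) + m' 5 = m' 5 + nn (ins e) by lia.
rewrite i7 //.
have [_ hz] := wf_ins he.
by rewrite !hz //; lia.
Qed.

Lemma CP_op2 G (F1 F2 : env G -> nat) (i : nat -> nat -> nat -> instr) op :
  (forall P O p m a b c q B Q, fetch P p (i a b c) ->
     wp P O p.+1 (upd m a (op (m b) (m c))) q B Q -> wp P O p m q B.+1 Q) ->
  CP F1 -> CP F2 -> CP (fun e => op (F1 e) (F2 e)).
Proof.
move=> hop [code1 [w1 h1]] [code2 [w2 h2]].
exists (fun av p t => code1 av p t ++ code2 av (p + size (code1 av p t)) t.+1 ++
  [:: i t t t.+1]), (w1 + w2.+2) => c.
have [c1 {}h1] := h1 c; have [c2 {}h2] := h2 c.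
have [c' hd] : dom false (fun I => bnd false c1 I + (bnd false c2 I + 1)) by dom.
exists c' => e he P av p t m W /placed_cat [hp1] /placed_cat [hp2] [hp3 _] hi ht hw hg hr.
apply: (wp_le _ (hd _)); rewrite !size_cat /=.
apply: wp_seq; first by apply: (h1 e he P av p t m W) => //; lia.
move=> m1 [e1 a1].
apply: wp_seq.
  apply: (h2 e he P av _ t.+1 m1 W) => //; try lia.
  - by apply: agree_inv a1 hi => //; lia.
  - exact: good_le hg _.
  - by apply: agree_rep hg a1 hr.
move=> m2 [e2 a2]; apply: (hop _ _ _ _ _ _ _ _ _ _ hp3).
apply: wp_done; last lia.
split; first by rewrite upd_eq e2; case: a2 => -> //; rewrite e1.
apply: agree_upd; try lia.
exact: agree_trans a1 a2.
Qed.

Lemma CP_add G (F1 F2 : env G -> nat) : CP F1 -> CP F2 -> CP (fun e => F1 e + F2 e).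
Proof. by apply: (@CP_op2 _ _ _ IAdd) => *; apply: wp_add; eassumption. Qed.

Lemma CP_sub G (F1 F2 : env G -> nat) : CP F1 -> CP F2 -> CP (fun e => F1 e - F2 e).
Proof. by apply: (@CP_op2 _ _ _ ISub) => *; apply: wp_sub; eassumption. Qed.

Section Loop.
Variables (G : ctx) (b1 b2 : bool).
Variables (N : env G -> nat) (f : env G -> nat -> nat -> nat) (x0 : env G -> nat).

(* Registers: t accumulator, t+1 remaining rounds, t+2 index. *)
Definition loop_code (cB : seq nat -> nat -> nat -> program) av p t :=
  let body := cB [:: t, t.+2 & av] p.+1 (t + 3) in
  let q := p.+1 + size body in
  IJz t.+1 (q + 7) :: body ++
  [:: IConst (t + 4) 0; IAdd t (t + 3) (t + 4); IConst (t + 4) 1; IAdd t.+2 t.+2 (t + 4);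
      ISub t.+1 t.+1 (t + 4); IConst (t + 4) 0; IJz (t + 4) p].

(** Induction on the number [r] of remaining rounds. Besides the body, a round costs 8 steps: the
    test and the seven instructions after the body. *)
Lemma loop_correct cB w c cb X e :
  computes (fun e : env (b2 :: b1 :: G) => f e.1.1 e.1.2 e.2) cB w c cb ->
  wf c e -> (forall j, j < N e -> j <= bnd b1 c (ins e)) ->
  (forall j, j <= N e -> X j = iteri j (f e) (x0 e)) ->
  (forall j, j <= N e -> X j <= bnd b2 c (ins e)) ->
  forall P av p t m0 m W r, placed P p (loop_code cB av p t) -> inv W (ins e) m0 -> 6 < t ->
    t + (w + 5) <= W -> good G av t -> rep av m0 e ->
  agree t W m0 m -> r <= N e -> m t = X (N e - r) -> m t.+1 = r -> m t.+2 = N e - r ->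
  wp P (orc (ins e)) p m (p + size (loop_code cB av p t)) (r * (bnd false cb (ins e) + 8) + 1)
    (fun m' => m' t = iteri (N e) (f e) (x0 e) /\ agree t W m0 m').
Proof.
move=> hB he hN hX hX2 P av p t m0 m W r hp hi ht hw hg hr.
have := hp => -[h1] /placed_cat [hb] [h2 [h3 [h4 [h5 [h6 [h7 [h8 _]]]]]]].
elim: r m => [|r IH] m ha hrN e0 e1 e2.
  apply: (wp_le (B1 := 1)); last lia.
  apply: (wp_jz0 h1 e1); apply: wp_done.
    by split=> //; rewrite e0 subn0 hX.
  by rewrite /= size_cat /=; lia.
apply: (wp_le (B1 := (bnd false cb (ins e) + (7 + (r * (bnd false cb (ins e) + 8) + 1))).+1)).
  2: lia.
apply: (wp_jzS h1); first by rewrite e1.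
have hir : inv W (ins e) m by apply: agree_inv ha hi => //; lia.
apply: wp_seq.
  apply: (hB ((e, N e - r.+1), X (N e - r.+1)) _ P _ _ (t + 3) m W hb hir).
  - by do !split=> //=; [apply: hN|apply: hX2]; lia.
  - lia.
  - lia.
  - case: hg => hg1 hg2; split=> /=; last by rewrite hg2.
    by apply/and3P; split; [lia|lia|apply: sub_all hg1 => a; lia].
  - by split=> //; split=> //=; apply: agree_rep hg ha hr.
move=> m' /= [e3 a3].
have a3' : agree t W m0 m' by apply: agree_trans ha a3; lia.
case: (a3) => a4 _.
rewrite -[7]/(6.+1) addSn; apply: (wp_const h2); apply: (wp_add h3); apply: (wp_const h4).
apply: (wp_add h5); apply: (wp_sub h6); apply: (wp_const h7); apply: (wp_jz0 h8); first by ups.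
apply: IH.
- by do !apply: agree_upd => //; lia.
- lia.
- ups; rewrite e3 addn0 /=.
  have -> : N e - r = (N e - r.+1).+1 by lia.
  by rewrite !hX ?iteriS //; lia.
- by ups; rewrite a4 ?e1; lia.
- by ups; rewrite a4 ?e2; lia.
Qed.

(** [H] has to bound all intermediate values, not just the last, as the body is only known to work
    in environments with bounded variables. *)
Lemma CP_iteri : CP N -> BD b1 N -> CP x0 ->
  CP (fun e : env (b2 :: b1 :: G) => f e.1.1 e.1.2 e.2) ->
  (exists2 H, BD b2 H & forall c e, wf c e -> forall j, j <= N e -> iteri j (f e) (x0 e) <= H e) ->
  CP (fun e => iteri (N e) (f e) (x0 e)).
Proof.
move=> [codeN [wN hN]] hBN [codex [wx hx]] [codeB [wB hB]] [H hBH hH].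
exists (fun av p t => let c1 := codex av p t in
  let c2 := codeN av (p + size c1) t.+1 in
  c1 ++ c2 ++ IConst t.+2 0 ::
  loop_code codeB av (p + size c1 + size c2).+1 t), (wx + wN + wB + 5) => c.
have [cN {}hN] := hN c; have [cx {}hx] := hx c.
have [cbN {}hBN] := hBN c; have [cH {}hBH] := hBH c.
(* A level that dominates the old variables, the index and the accumulator at once; the body is
   instantiated there. *)
pose c' := c + cbN + cH.
have [cB {}hB] := hB c'.
have [cc hd] : dom false (fun I => bnd false cx I + (bnd false cN I +
  (bnd b1 cbN I * (bnd false cB I + 8) + 1).+1)) by dom.
exists cc => e he P av p t m W /placed_cat [hp1] /placed_cat [hp2] [hp3 hp4] hi ht hw hg hr.
apply: (wp_le _ (hd _)); rewrite !size_cat.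
apply: wp_seq; first by apply: (hx e he P av p t m W) => //; lia.
move=> m1 [e1 a1].
apply: wp_seq.
  apply: (hN e he P av _ t.+1 m1 W) => //; try lia.
  - by apply: agree_inv a1 hi => //; lia.
  - exact: good_le hg _.
  - by apply: agree_rep hg a1 hr.
move=> m2 [e2 a2]; apply: (wp_const hp3).
have hwf : wf c' e by apply: wf_le he _; rewrite /c'; lia.
set L := loop_code _ _ _ _.
have -> : p + (size (codex av p t) + (size (codeN av (p + size (codex av p t)) t.+1) +
   size (IConst t.+2 0 :: L))) =
   (p + size (codex av p t) + size (codeN av (p + size (codex av p t)) t.+1)).+1 + size L
  by rewrite /=; lia.
apply: (wp_le (B1 := N e * (bnd false cB (ins e) + 8) + 1)); last first.
  by rewrite leq_add2r leq_mul2r hBN // orbT.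
apply: (loop_correct (X := fun j => iteri j (f e) (x0 e)) hB hwf) => //; try eassumption.
- move=> j hj; apply: leq_trans (bnd_leq _ _ (_ : cbN <= _)); last by rewrite /c'; lia.
  by apply: leq_trans (ltnW hj) (hBN _ he).
- move=> j hj; apply: leq_trans (hH _ _ he _ hj) _.
  by apply: leq_trans (hBH _ he) (bnd_leq _ _ _); rewrite /c'; lia.
- lia.
- apply: agree_upd; [lia|lia|]; exact: agree_trans a1 a2.
- by ups; rewrite subnn /=; case: a2 => -> //.
- by ups.
- by ups; rewrite subnn.
Qed.

End Loop.

Section Query.
Variables (G : ctx) (L v : env G -> nat) (Z : env G -> nat -> nat).

(* Registers: t agent, t+1 to t+4 the two segments, t+5 remaining rounds, t+6 index. *)
Definition query_loop (cB : seq nat -> nat -> nat -> program) av p t :=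
  let body := cB (t + 6 :: av) p.+1 (t + 7) in
  let q := p.+1 + size body in
  IJz (t + 5) (q + 7) :: body ++
  [:: IStore 6 (t + 7); IConst (t + 7) 1; IAdd 6 6 (t + 7); IAdd (t + 6) (t + 6) (t + 7);
      ISub (t + 5) (t + 5) (t + 7); IConst (t + 7) 0; IJz (t + 7) p].

Definition pushed t W q j e (m m' : nat -> nat) :=
  [/\ m' 6 = q + j, forall a, a < t -> a != 6 -> m' a = m a,
      forall a, W <= a -> a < q -> m' a = m a &
      forall i, i < j -> m' (q + i) = Z e i].

Lemma query_loop_correct cB w c cb e :
  computes (fun e : env (false :: G) => Z e.1 e.2) cB w c cb ->
  wf c e -> (L e).*2 <= bnd false c (ins e) ->
  forall P av p t m0 m W r, placed P p (query_loop cB av p t) -> inv W (ins e) m0 -> 6 < t ->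
    t + (w + 8) <= W -> good G av t -> rep av m0 e ->
  pushed (t + 5) W (m0 6) ((L e).*2 - r) e m0 m -> r <= (L e).*2 ->
  m (t + 5) = r -> m (t + 6) = (L e).*2 - r ->
  wp P (orc (ins e)) p m (p + size (query_loop cB av p t)) (r * (bnd false cb (ins e) + 8) + 1)
    (fun m' => pushed (t + 5) W (m0 6) (L e).*2 e m0 m').
Proof.
move=> hB he hL P av p t m0 m W r hp hi ht hw hg hr.
have := hp => -[h1] /placed_cat [hb] [h2 [h3 [h4 [h5 [h6 [h7 [h8 _]]]]]]].
set n2 := (L e).*2 in hL *.
elim: r m => [|r IH] m ha hrN e1 e2.
  apply: (wp_le (B1 := 1)); last lia.
  apply: (wp_jz0 h1 e1); apply: wp_done; first by rewrite subn0 in ha.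
  by rewrite /= size_cat /=; lia.
apply: (wp_le (B1 := (bnd false cb (ins e) + (7 + (r * (bnd false cb (ins e) + 8) + 1))).+1)).
  2: lia.
apply: (wp_jzS h1); first by rewrite e1.
case: (ha) => p1 p2 p3 p4.
case: (hi) => -[i0 i1 i2 i3 i4] [i5 i6 i7].
have hir : inv W (ins e) m.
  rewrite /inv p1 !p2 //; try lia; do !split=> //; first lia.
  by move=> j hj; rewrite p3 ?i7; lia.
have hrr : rep av m e by apply: rep_ext hg _ hr => a ?; rewrite p2 //; lia.
apply: wp_seq.
  apply: (hB (e, n2 - r.+1) _ P _ _ (t + 7) m W hb hir).
  - by split=> //=; lia.
  - lia.
  - lia.
  - case: hg => hg1 hg2; split=> /=; last by rewrite hg2.
    by apply/andP; split; [lia|apply: sub_all hg1 => a; lia].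
  - by split.
move=> m' /= [e3 [a4 a5]].
rewrite -[7]/(6.+1) addSn; apply: (wp_store h2); apply: (wp_const h3); apply: (wp_add h4).
apply: (wp_add h5); apply: (wp_sub h6); apply: (wp_const h7); apply: (wp_jz0 h8); first by ups.
have e6 : m' 6 = m0 6 + (n2 - r.+1) by rewrite a4 ?p1; lia.
rewrite e6 in IH *.
have h6W : W <= m0 6 by lia.
apply: IH.
- split.
  + by ups; rewrite e6; lia.
  + by move=> a ha1 ha2; ups; rewrite a4 ?p2 //; lia.
  + move=> a ha1 ha2; ups; rewrite a5 ?(p3 a) //; lia.
  + move=> i hir'; case: (ltngtP i (n2 - r.+1)) => hi2; last 2 first.
    * lia.
    * by rewrite hi2; ups; rewrite e3.
    * by ups; rewrite a5 ?p4 //; lia.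
- lia.
- by ups; rewrite a4 ?e1; lia.
- by ups; rewrite a4 ?e2; lia.
Qed.

(** A single loop pushes both argument lists back to back, so the second one starts [L] cells after
    the first. *)
Lemma CP_query : CP L -> BD false L -> CP v ->
  CP (fun e : env (false :: G) => Z e.1 e.2) ->
  CP (fun e => orc (ins e) (v e) (mkseq (Z e) (L e)) (mkseq (fun j => Z e (L e + j)) (L e)) : nat).
Proof.
move=> [codeL [wL hL]] hBL [codev [wv hv]] [codeB [wB hB]].
exists (fun av p t => let c1 := codev av p t in
  let c2 := codeL av (p + size c1) t.+2 in
  let q := p + size c1 + size c2 + 6 in
  let lp := query_loop codeB av q t in
  c1 ++ c2 ++ [:: IConst (t + 4) 0, IAdd (t + 1) 6 (t + 4), IAdd (t + 4) (t + 2) (t + 4),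
    IAdd (t + 3) 6 (t + 4), IAdd (t + 5) (t + 2) (t + 2), IConst (t + 6) 0 &
    (* The stack is popped before the query is put: the two lists still lie untouched just above its
       top. *)
    lp ++ [:: IAdd (t + 7) (t + 2) (t + 2); ISub 6 6 (t + 7); IQuery t]]),
  (wL + wv + wB + 8) => c.
have [cL {}hL] := hL c; have [cv {}hv] := hv c; have [cbL {}hBL] := hBL c.
have [cL2 hL2] : dom false (fun I => bnd false cbL I + bnd false cbL I) by dom.
pose c' := c + cL2.
have [cB {}hB] := hB c'.
have [cc hd] : dom false (fun I => bnd false cv I + (bnd false cL I +
  (bnd false cL2 I * (bnd false cB I + 8) + 1 + 3).+4.+2)) by dom.
exists cc => e he P av p t m W /placed_cat [hp1] /placed_cat [hp2].
move=> [h1 [h2 [h3 [h4 [h5 [h6 h]]]]]] hi ht hw hg hr.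
have {h} /placed_cat [hp3 [h7 [h8 [h9 _]]]] : placed P _ (query_loop codeB av _ t ++ _) := h.
apply: (wp_le _ (hd _)); rewrite !size_cat.
apply: wp_seq; first by apply: (hv e he P av p t m W) => //; lia.
move=> m1 [e1 a1].
apply: wp_seq.
  apply: (hL e he P av _ t.+2 m1 W) => //; try lia.
  - by apply: agree_inv a1 hi => //; lia.
  - by apply: good_le hg _; lia.
  - by apply: agree_rep hg a1 hr.
move=> m2 [e2 a2].
have a3 : agree t W m m2 by apply: agree_trans a1 a2; lia.
have e1' : m2 t = v e by case: a2 => -> //; lia.
have hi2 : inv W (ins e) m2 by apply: agree_inv a3 hi => //; lia.
apply: (wp_const h1); apply: (wp_add h2); apply: (wp_add h3); apply: (wp_add h4).
apply: (wp_add h5); apply: (wp_const h6).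
set m3 := upd _ (t + 6) 0.
have a4 : agree t W m m3 by do !apply: agree_upd => //; lia.
have hi3 : inv W (ins e) m3 by apply: agree_inv a4 hi => //; lia.
have e36 : m3 6 = m2 6 by rewrite /m3; ups.
have e31 : m3 (t + 1) = m2 6 by rewrite /m3; ups; rewrite addn0.
have e32 : m3 (t + 2) = L e by rewrite /m3; ups; rewrite addn2.
have e34 : m3 (t + 4) = L e by rewrite /m3; ups; rewrite addn0 addn2.
have e33 : m3 (t + 3) = m2 6 + L e by rewrite /m3; ups; rewrite addn0 addn2 e2.
have e35 : m3 (t + 5) = (L e).*2 by rewrite /m3; ups; rewrite addn2 e2 addnn.
have e30 : m3 t = v e by rewrite /m3; ups.
have e3z : m3 (t + 6) = 0 by rewrite /m3; ups.
clearbody m3.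
have hL' : (L e).*2 <= bnd false cL2 (ins e).
  by apply: leq_trans (hL2 _); have := hBL _ he; lia.
have hwf : wf c' e by apply: wf_le he _; rewrite /c'; lia.
have hp3' : placed P (p + size (codev av p t) + size (codeL av (p + size (codev av p t)) t.+2) + 6)
    (query_loop codeB av (p + size (codev av p t) + size (codeL av (p + size (codev av p t)) t.+2) + 6) t).
  by rewrite [X in placed _ X](_ : _ = (p + size (codev av p t) + size (codeL av (p + size (codev av p t)) t.+2)).+4.+2) //; lia.
have hq : (p + size (codev av p t) + size (codeL av (p + size (codev av p t)) t.+2)).+4.+2 =
  p + size (codev av p t) + size (codeL av (p + size (codev av p t)) t.+2) + 6 by lia.
rewrite hq in h7 h8 h9 *.
apply: wp_seq.
  apply: (wp_le (B1 := (L e).*2 * (bnd false cB (ins e) + 8) + 1)); last first.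
    by rewrite leq_add2r leq_mul2r hL' orbT.
  apply: (query_loop_correct hB hwf _ hp3' hi3 ht) => //.
  - by apply: leq_trans hL' (bnd_leq _ _ _); rewrite /c'; lia.
  - lia.
  - by apply: agree_rep hg a4 hr.
  - by rewrite subnn; split=> //; lia.
  - by rewrite subnn.
move=> m4 [q1 q2 q3 q4].
apply: (wp_add h7); apply: (wp_sub h8); apply: (wp_query h9).
case: hi3 => _ [i5 i6 _].
apply: wp_done; last by rewrite /= !size_cat /=; lia.
split.
  rewrite upd_eq.
  set m5 := upd (upd _ _ _) 6 _.
  have hm5 a : a < t + 5 -> a != 6 -> m5 a = m3 a.
    by move=> ha hb; rewrite /m5; ups; rewrite q2.
  rewrite (hm5 t) ?(hm5 (t + _)) ?e30 ?e31 ?e32 ?e33 ?e34; try lia.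
  have hrd s : read_seq m5 (m2 6 + s) (L e) = mkseq (fun j => m4 (m2 6 + (s + j))) (L e).
    rewrite /read_seq /mkseq; apply: eq_map => k.
    by rewrite /m5; ups; rewrite addnA.
  have := hrd 0; rewrite addn0 => ->; rewrite hrd.
  congr (nat_of_bool (orc _ _ _ _)); apply/eq_in_map => k; rewrite mem_iota => hk;
    by rewrite -e36 q4 //; lia.
split=> a ha.
  case: (eqVneq a 6) => [->|ha6].
    have hm6 : m2 6 = m 6 by case: a3 => h _; apply: h.
    by ups; rewrite q1 e36 (q2 (t + 2)) ?e32 ?hm6; lia.
  by ups; rewrite q2 //; [case: a4 => -> | lia].
move=> ha2; ups; rewrite q3 //; first by case: a4 => _ ->.
by case: a4 => h _; rewrite h.
Qed.

End Query.

(** * Expressions computable within the time bound *)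

(** Bounded quantifiers are read off from bounded sums, so a single closure lemma for [iteri] serves
    them all. *)
Definition sumI N (g : nat -> nat) := iteri N (fun i x => x + g i) 0.
Definition anyb N (p : nat -> bool) := 0 < sumI N p.
Definition allb N (p : nat -> bool) := sumI N p == N.

Lemma sumIE N g : sumI N g = \sum_(i < N) g i.
Proof. by elim: N => [|N IH]; rewrite ?big_ord0 // big_ord_recr -IH. Qed.

Lemma sumI_le N g h : (forall i, i < N -> g i <= h i) -> sumI N g <= sumI N h.
Proof. by move=> hh; rewrite !sumIE; apply: leq_sum => i _; apply: hh. Qed.

Lemma sumI_cst N x : sumI N (fun=> x) = N * x.
Proof. by rewrite sumIE sum_nat_const card_ord. Qed.

Lemma sumI_leM N g x : (forall i, i < N -> g i <= x) -> sumI N g <= N * x.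
Proof. by move=> h; rewrite -sumI_cst; apply: sumI_le. Qed.

Lemma anybP N (p : nat -> bool) : reflect (exists2 i, i < N & p i) (anyb N p).
Proof.
rewrite /anyb sumIE lt0n sum_nat_eq0; apply: (iffP idP).
  by case/forallPn => i; rewrite eqb0 negbK => ?; exists i.
by case=> i hi pi; apply/forallPn; exists (Ordinal hi); rewrite eqb0 negbK.
Qed.

Lemma allbP N (p : nat -> bool) : reflect (forall i, i < N -> p i) (allb N p).
Proof.
have e : sumI N p + sumI N (fun i => ~~ p i) = N.
  rewrite !sumIE -big_split -[RHS]muln1 -[X in X * _]card_ord -sum_nat_const.
  by apply: eq_bigr => i _ /=; case: (p i).
apply: (iffP eqP) => [h i hi|h].
  apply/negPn/negP => hp; have/anybP : exists2 i, i < N & ~~ p i by exists i.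
  by rewrite /anyb; lia.
suff: ~~ anyb N (fun i => ~~ p i) by rewrite /anyb; lia.
by apply/anybP => -[i /h ->].
Qed.

Lemma FP_cst G b x : FP b (fun _ : env G => x).
Proof. by split; [apply: BD_cst|apply: CP_cst]. Qed.

Lemma FP_n G : FP false (fun e : env G => nn (ins e)).
Proof.
split; last by apply: (@CP_glob _ _ 0) => // e W m [[]].
by apply: (@BD_dom _ _ _ (fun _ I => nn I)) => // _; exists 1 => I; rewrite /bnd expn1; have := tw_gt0 (gm I + sg I + 1); nia.
Qed.

Lemma FP_gm G b : FP b (fun e : env G => gm (ins e)).
Proof.
apply: FP_weak; split; last by apply: (@CP_glob _ _ 1) => // e W m [[]].
apply: (@BD_dom _ _ _ (fun _ I => gm I)) => // _; exists 0 => I; rewrite /bnd.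
by have := tw_gtn (gm I + sg I + 0); lia.
Qed.

Lemma FP_sg G b : FP b (fun e : env G => sg (ins e)).
Proof.
apply: FP_weak; split; last by apply: (@CP_glob _ _ 2) => // e W m [[]].
apply: (@BD_dom _ _ _ (fun _ I => sg I)) => // _; exists 0 => I; rewrite /bnd.
by have := tw_gtn (gm I + sg I + 0); lia.
Qed.

Lemma FP_var G b : FP b (fun e : env (b :: G) => e.2).
Proof. by split; [apply: BD_var|apply: CP_var]. Qed.

Lemma FP_col G b F : FP false F -> FP b (fun e : env G => cl (ins e) (F e)).
Proof.
move=> [_ h]; split; last exact: CP_col.
case: (FP_gm G b) => hb _; apply: BD_le hb => c e /wf_ins[h1 _]; exact: h1.
Qed.

Lemma FP_add G b (F1 F2 : env G -> nat) : FP b F1 -> FP b F2 -> FP b (fun e => F1 e + F2 e).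
Proof. by move=> [h1 h1'] [h2 h2']; split; [apply: BD_add|apply: CP_add]. Qed.

Lemma FP_S G b (F : env G -> nat) : FP b F -> FP b (fun e => (F e).+1).
Proof.
by move=> h; apply: FP_ext (FP_add h (FP_cst _ _ 1)) => c e _; rewrite addn1.
Qed.

Lemma FP_sub G b b2 (F1 F2 : env G -> nat) : FP b F1 -> FP b2 F2 -> FP b (fun e => F1 e - F2 e).
Proof.
move=> [h1 h1'] [h2 h2']; split; last exact: CP_sub.
by apply: BD_le h1 => *; apply: leq_subr.
Qed.

(** The bound on the number of coalitions is an arbitrary input that obeys no growth class. Only its
    minimum with [n] does, and it is obtained as [r - (r - n)]. *)
Lemma FP_r1 G : FP false (fun e : env G => minn (rh1 (ins e)) (nn (ins e))).
Proof.
split; first by case: (FP_n G) => h _; apply: BD_le h => *; rewrite geq_minr.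
have h : CP (fun e : env G => rh1 (ins e)) by apply: (@CP_glob _ _ 3) => // e W m [[]].
apply: CP_ext (CP_sub h (CP_sub h (FP_n G).2)) => c e _; lia.
Qed.

Lemma FP_r2 G : FP false (fun e : env G => minn (rh2 (ins e)) (nn (ins e))).
Proof.
split; first by case: (FP_n G) => h _; apply: BD_le h => *; rewrite geq_minr.
have h : CP (fun e : env G => rh2 (ins e)) by apply: (@CP_glob _ _ 4) => // e W m [[]].
apply: CP_ext (CP_sub h (CP_sub h (FP_n G).2)) => c e _; lia.
Qed.

Lemma FP_sum G b b1 (N : env G -> nat) (g : env G -> nat -> nat) :
  FP b1 N -> BD b N -> FP b (fun e : env (b1 :: G) => g e.1 e.2) ->
  FP b (fun e => sumI (N e) (g e)).
Proof.
move=> [h1 h1'] hN [h2 h2'].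
have hB : exists2 H, BD b H &
    forall c (e : env G), wf c e -> forall j, j <= N e -> sumI j (g e) <= H e.
  pose H (e : env G) := sumI (N e) (g e); exists H.
    move=> c; have [c1 hc1] := hN c; have [c1' hc1'] := h1 c.
    have [c2 hc2] := h2 (c + c1'); have [c3 hc3] := dom_mul (dom_bnd b c1) (dom_bnd b c2).
    exists c3 => e he; apply: leq_trans (hc3 _).
    apply: (leq_trans (sumI_leM (x := bnd b c2 (ins e)) _)); last by rewrite leq_mul2r hc1 // orbT.
    move=> i hi; apply: (hc2 (e, i)); split=> /=; first by apply: wf_le he _; lia.
    apply: leq_trans (ltnW hi) _; apply: leq_trans (hc1' _ he) (bnd_leq _ _ _); lia.
  move=> c e _ j hj; rewrite /H !sumIE -(subnKC hj) big_split_ord /=; exact: leq_addr.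
split; first by case: hB => H hH hh; apply: BD_le hH => c e /hh; apply.
apply: (@CP_iteri _ b1 b N (fun e i x => x + g e i) (fun=> 0)) => //.
- exact: CP_cst.
- by apply: CP_add; [apply: CP_var|apply: (CP_wk b h2')].
Qed.

Lemma FP_sumT G b (N : env G -> nat) (g : env G -> nat -> nat) :
  FP true N -> FP b (fun e : env (true :: G) => g e.1 e.2) ->
  FP b (fun e => sumI (N e) (g e)).
Proof. by move=> h1; apply: FP_sum => //; case: h1 => h _; apply: BD_weak. Qed.

Lemma FP_sumF G (N : env G -> nat) (g : env G -> nat -> nat) :
  FP false N -> FP false (fun e : env (false :: G) => g e.1 e.2) ->
  FP false (fun e => sumI (N e) (g e)).
Proof. by move=> h1; apply: FP_sum => //; case: h1. Qed.

Lemma FP_leq G b (F1 F2 : env G -> nat) : FP false F1 -> FP false F2 ->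
  FP b (fun e => (F1 e <= F2 e) : nat).
Proof.
move=> h1 h2; apply: FP_bool.
apply: CP_ext (CP_sub (CP_cst _ 1) (CP_sub h1.2 h2.2)) => c e _; lia.
Qed.

Lemma FP_andb G b (P Q : env G -> bool) : FP b (fun e => P e : nat) -> FP b (fun e => Q e : nat) ->
  FP b (fun e => (P e && Q e) : nat).
Proof.
move=> h1 h2; apply: FP_bool.
apply: CP_ext (CP_sub (CP_add h1.2 h2.2) (CP_cst _ 1)) => c e _; lia.
Qed.

Lemma FP_negb G b (P : env G -> bool) : FP b (fun e => P e : nat) -> FP b (fun e => ~~ P e : nat).
Proof.
move=> h1; apply: FP_bool.
by apply: CP_ext (CP_sub (CP_cst _ 1) h1.2) => c e _; case: (P e).
Qed.

Lemma FP_orb G b (P Q : env G -> bool) : FP b (fun e => P e : nat) -> FP b (fun e => Q e : nat) ->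
  FP b (fun e => (P e || Q e) : nat).
Proof.
move=> h1 h2; apply: FP_ext (FP_negb (FP_andb (FP_negb h1) (FP_negb h2))) => c e _.
by rewrite negb_and !negbK.
Qed.

Lemma FP_implyb G b (P Q : env G -> bool) : FP b (fun e => P e : nat) -> FP b (fun e => Q e : nat) ->
  FP b (fun e => (P e ==> Q e) : nat).
Proof.
by move=> h1 h2; apply: FP_ext (FP_orb (FP_negb h1) h2) => c e _; rewrite implybE.
Qed.

Lemma FP_eqn G b (F1 F2 : env G -> nat) : FP false F1 -> FP false F2 ->
  FP b (fun e => (F1 e == F2 e) : nat).
Proof.
move=> h1 h2; apply: FP_ext (FP_andb (FP_leq b h1 h2) (FP_leq b h2 h1)) => c e _.
by rewrite eqn_leq.
Qed.

Lemma FP_anyT G b (N : env G -> nat) (p : env G -> nat -> bool) :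
  FP true N -> FP false (fun e : env (true :: G) => p e.1 e.2 : nat) ->
  FP b (fun e => anyb (N e) (p e) : nat).
Proof.
move=> h1 h2; apply: FP_leq; first exact: FP_cst.
exact: FP_sumT.
Qed.

Lemma FP_anyF G b (N : env G -> nat) (p : env G -> nat -> bool) :
  FP false N -> FP false (fun e : env (false :: G) => p e.1 e.2 : nat) ->
  FP b (fun e => anyb (N e) (p e) : nat).
Proof.
move=> h1 h2; apply: FP_leq; first exact: FP_cst.
exact: FP_sumF.
Qed.

Lemma FP_allT G b (N : env G -> nat) (p : env G -> nat -> bool) :
  FP true N -> FP false (fun e : env (true :: G) => p e.1 e.2 : nat) ->
  FP b (fun e => allb (N e) (p e) : nat).
Proof.
move=> h1 h2; apply: FP_eqn; last exact: FP_weak.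
exact: FP_sumT.
Qed.

(** A conditional is a loop executed once or not at all, which replaces the value of [F2] by that of
    [F1]. *)
Lemma FP_if G b (P : env G -> bool) (F1 F2 : env G -> nat) : FP b (fun e => P e : nat) ->
  FP b F1 -> FP b F2 -> FP b (fun e => if P e then F1 e else F2 e).
Proof.
move=> h h1 h2.
have hB : BD b (fun e => if P e then F1 e else F2 e).
  by apply: BD_le (BD_add h1.1 h2.1) => c e _; case: (P e); lia.
split=> //.
apply: (@CP_ext _ (fun e => iteri (P e : nat) (fun _ _ => F1 e) (F2 e))) => [c e _|].
  by case: (P e).
apply: (@CP_iteri _ b b _ (fun e _ _ => F1 e) F2) h.2 h.1 h2.2 (CP_wk b (CP_wk b h1.2)) _.
exists (fun e => F1 e + F2 e); first exact: BD_add h1.1 h2.1.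
by move=> c e _ [|j] _ /=; lia.
Qed.

Lemma FP_mul G b (F1 F2 : env G -> nat) : FP b F1 -> FP b F2 -> FP b (fun e => F1 e * F2 e).
Proof.
move=> h1 h2; apply: FP_ext (@FP_sum _ _ _ _ (fun e _ => F2 e) h1 h1.1 (FP_wk b h2)) => c e _.
exact: sumI_cst.
Qed.

Lemma FP_pow G (F1 F2 : env G -> nat) : FP true F1 -> FP true F2 ->
  FP true (fun e => F1 e ^ F2 e).
Proof.
move=> h1 h2; split; first exact: BD_pow h1.1 h2.1.
have e x y : iteri y (fun _ z => z * x) 1 = x ^ y by elim: y => //= y ->; rewrite expnSr.
apply: (@CP_ext _ (fun e => iteri (F2 e) (fun _ z => z * F1 e) 1)) => [c' e' _|] //.
apply: (@CP_iteri _ true true _ (fun e _ z => z * F1 e) (fun=> 1)) h2.2 h2.1 (CP_cst _ 1) _ _.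
  exact: (FP_mul (FP_var _ _) (FP_wk true (FP_wk true h1))).2.
(* The successor makes the bound monotone in the exponent even if [F1] vanishes. *)
exists (fun e => (F1 e).+1 ^ F2 e); first by apply: BD_pow (FP_S h1).1 h2.1.
move=> c' e' _ j hj; rewrite e; apply: leq_trans (_ : (F1 e').+1 ^ j <= _).
  by case: j {hj} => // j; rewrite leq_exp2r.
by rewrite leq_pexp2l.
Qed.

(** Division by counting the multiples of [d] up to [a]; the guard reproduces the convention that
    dividing by 0 gives 0. *)
Lemma divn_sumI a d : a %/ d = sumI a (fun q => (0 < d) && (q.+1 * d <= a)).
Proof.
case: d => [|d]; first by rewrite divn0 sumIE big1.
have h n : n >= a %/ d.+1 -> sumI n (fun q => q.+1 * d.+1 <= a) = a %/ d.+1.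
  move/subnKC <-; elim: (n - _) => [|m IH].
    rewrite addn0 -[RHS]muln1 -sumI_cst !sumIE; apply: eq_bigr => -[i hi] _ /=.
    by move: hi; rewrite leq_divRL // => ->.
  rewrite addnS /sumI /= -/(sumI _ _) IH -leq_divRL //; lia.
by rewrite -[LHS](h a) ?leq_div.
Qed.

Lemma FP_div G b (F1 F2 : env G -> nat) : FP b F1 -> FP false F2 ->
  FP b (fun e => F1 e %/ F2 e).
Proof.
move=> h1 h2; apply: (@FP_ext _ _ (fun e => sumI (F1 e) (fun q => (0 < F2 e) && (q.+1 * F2 e <= F1 e)))).
  by move=> c e _; rewrite -divn_sumI.
apply: (FP_sum h1 h1.1); apply: FP_andb; first exact: FP_leq (FP_cst _ _ _) (FP_wk _ h2).
apply: FP_leq; last exact: FP_wk (FP_false h1).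
apply: FP_mul (FP_wk _ h2); apply: FP_S; exact: FP_false (FP_var _ _).
Qed.

Lemma FP_mod G b (F1 F2 : env G -> nat) : FP b F1 -> FP false F2 ->
  FP b (fun e => F1 e %% F2 e).
Proof.
move=> h1 h2; apply: FP_ext (FP_sub h1 (FP_mul (FP_div (FP_false h1) h2) h2)) => c e _.
by rewrite {1}(divn_eq (F1 e) (F2 e)) addKn.
Qed.

Definition dig B x j := x %/ B ^ j %% B.

Lemma FP_dig G b (F1 F2 F3 : env G -> nat) : FP true F1 -> FP b F2 -> FP true F3 ->
  FP b (fun e => dig (F1 e) (F2 e) (F3 e)).
Proof.
move=> h1 h2 h3; apply: FP_mod (FP_false h1); apply: FP_div => //.
exact: FP_false (FP_pow h1 h3).
Qed.

(** Repeated halving never exceeds [x], whereas dividing by [2 ^ k] would form a number exponential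
    in [n]. *)
Definition shiftr x k := iteri k (fun _ y => y %/ 2) x.

Lemma FP_shiftr G b (F1 F2 : env G -> nat) : FP b F1 -> FP false F2 ->
  FP b (fun e => shiftr (F1 e) (F2 e)).
Proof.
move=> h1 h2.
have hj x j : shiftr x j <= x.
  by elim: j => // j IH; apply: leq_trans IH; rewrite /shiftr /= leq_div.
split; first by apply: BD_le h1.1.
apply: (@CP_iteri _ false b _ (fun e _ y => y %/ 2) _) h2.2 h2.1 h1.2 _ _.
  exact: (FP_div (FP_var _ b) (FP_cst _ _ 2)).2.
by exists F1; [exact: h1.1|move=> *; apply: hj].
Qed.

(** The number of rounds may grow with [n] while the accumulator stays bounded in the parameters;
    hence [H] must bound [f] uniformly in the round and in the previous value. The programme over
    the bits has this shape. *)
Lemma FP_iteriF G (N : env G -> nat) f x0 H : FP false N -> FP true x0 -> FP true H ->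
  FP true (fun e : env (true :: false :: G) => f e.1.1 e.1.2 e.2) ->
  (forall e i x, f e i x <= H e) ->
  FP true (fun e => iteri (N e) (f e) (x0 e)).
Proof.
move=> hN hx hH hf hfH.
have hb e j : iteri j (f e) (x0 e) <= x0 e + H e.
  by case: j => [|j] /=; [exact: leq_addr|apply: leq_trans (hfH _ _ _) (leq_addl _ _)].
split; first by apply: BD_le (BD_add hx.1 hH.1).
apply: (@CP_iteri _ false true _ f _) hN.2 hN.1 hx.2 hf.2 _.
by exists (fun e => x0 e + H e); [exact: BD_add hx.1 hH.1|].
Qed.

(* Both sets of the query are filtered out of [0, n), padding with the non-agent [n]. *)
Lemma FP_query G b (v : env G -> nat) (p q : env G -> nat -> bool) :
  FP false v -> FP false (fun e : env (false :: G) => p e.1 e.2 : nat) ->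
  FP false (fun e : env (false :: G) => q e.1 (e.2 - nn (ins e)) : nat) ->
  FP b (fun e => orc (ins e) (v e)
    (mkseq (fun j => if p e j then j else nn (ins e)) (nn (ins e)))
    (mkseq (fun j => if q e j then j else nn (ins e)) (nn (ins e))) : nat).
Proof.
move=> hv hp hq; apply: FP_bool.
pose Z e j := if j < nn (ins e) then (if p e j then j else nn (ins e))
              else if q e (j - nn (ins e)) then j - nn (ins e) else nn (ins e).
apply: CP_ext (CP_query (Z := Z) (FP_n G).2 (FP_n G).1 hv.2 _) => [c e _|].
  congr (nat_of_bool (orc _ _ _ _)); apply/eq_in_map => j; rewrite mem_iota add0n => /= hj.
    by rewrite /Z hj.
  by rewrite /Z ltnNge leq_addr /= addKn.
apply: (proj2 (A := BD false _)); apply: FP_if.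
- exact: FP_leq (FP_S (FP_var _ _)) (FP_n _).
- exact: FP_if hp (FP_var _ _) (FP_n _).
- exact: FP_if hq (FP_sub (FP_var _ _) (FP_n _)) (FP_n _).
Qed.

(** * The decision procedure *)

Section Algorithm.
Variables (ind : bool) (I : inst).

(** The base is [sg + 2] because a coalition of size at most [sg], joined by a deviator, may have
    [sg + 1] members of one colour. *)
Definition dcodes := (sg I + 2) ^ gm I.
Definition rank a := sumI (nn I) (fun a' => (a' < a) && (cl I a' == cl I a)).

(* The code d prescribes how many agents of each colour to take; the first ones are. *)
Definition sample d a := rank a < dig (sg I + 2) d (cl I a).
Definition asks i d d' := orc I i
  (mkseq (fun j => if sample d j then j else nn I) (nn I))
  (mkseq (fun j => if sample d' j then j else nn I) (nn I)).

(* A type is the colour followed by the truth table of the preference. *)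
Definition tables := 2 ^ (dcodes * dcodes).
Definition typ i := cl I i * tables +
  sumI (dcodes * dcodes) (fun x => 2 ^ x * asks i (x %/ dcodes) (x %% dcodes)).
Definition types := gm I * tables.
Definition prefers t d d' := dig 2 t (d * dcodes + d') == 1.
Definition supply t := sumI (nn I) (fun i => typ i == t).

(* A coalition is coded in base sigma + 1 by how many members of each type it has. *)
Definition cods := (sg I + 1) ^ types.
Definition mult V t := dig (sg I + 1) V t.
(** What one agent of type [t] adds to a palette code, [t %/ tables] being its colour. Thus
    [pal V + weight t] codes the coalition after its arrival. *)
Definition weight t := (sg I + 2) ^ (t %/ tables).
Definition pal V := sumI types (fun t => mult V t * weight t).
Definition csize V := sumI types (mult V).

(** [U] is the kind of the present coalition of the deviator, [V] that of its target. The flag [ind]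
    adds the consent of the target and so selects individual stability. *)
Definition deviates t U V :=
  [&& prefers t (pal V + weight t) (pal U), ~~ prefers t (pal U) (pal V + weight t) &
   ind ==> allb types (fun t' => (0 < mult V t') ==> prefers t' (pal V + weight t) (pal V))].

(* The base 3 digits of s are the multiplicities of the coalition codes, capped
   at 2; the empty coalition must be present. *)
Definition stable_support s := (0 < dig 3 s 0) && allb cods (fun U => (0 < dig 3 s U) ==>
  (csize U <= sg I) && allb cods (fun V => (0 < dig 3 s V) && ((U != V) || (dig 3 s U == 2)) ==>
    allb types (fun t => (0 < mult U t) ==> ~~ deviates t U V))).

(** One equation per type, one for the number of nonempty coalitions and one for the number of
    non-trivial ones. *)
Definition rows := types + 2.
Definition coef r U := if r < types then mult U r
  else if r == types then (U != 0) : nat else (1 < csize U) : nat.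
Definition rhs N1 N2 r := if r < types then supply r else if r == types then N1 else N2.

(* coef (s + y) = rhs is solved for y bit by bit, lowest first; a set of
   reachable carry vectors is a bit mask over base cbase codes. *)
Definition cbase := 2 * (cods * (sg I + 1)) + 1.
(** The guessed capped multiplicities enter as the initial carry, so that only the excess [y] is
    treated bit by bit. *)
Definition carry0 s := sumI rows (fun r =>
  cbase ^ r * sumI cods (fun U => coef r U * dig 3 s U)).
(** One column of a long addition: the old carry [c] plus the contribution of the current bits of
    [y] gives the current bit of the right-hand side and the new carry [c']. An excess is allowed
    only where the guess is 2, since smaller guesses are exact. *)
Definition carry_ok s N1 N2 k c' c y :=
  allb cods (fun U => (dig 2 y U == 1) ==> (dig 3 s U == 2)) &&
  allb rows (fun r => 2 * dig cbase c' r + shiftr (rhs N1 N2 r) k %% 2 ==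
    dig cbase c r + sumI cods (fun U => coef r U * dig 2 y U)).
Definition carry_next s N1 N2 k mask := sumI (cbase ^ rows) (fun c' =>
  2 ^ c' * anyb (cbase ^ rows) (fun c => (dig 2 mask c == 1) &&
    anyb (2 ^ cods) (carry_ok s N1 N2 k c' c))).
(** Right-hand sides are at most [n < 2 ^ (n + 1)], so [n + 1] bits exhaust them. *)
Definition carries s N1 N2 := iteri (nn I + 1) (carry_next s N1 N2) (2 ^ carry0 s).

(** Acceptance needs the zero carry vector, whose code is 0. Capping the two bounds at [n] is
    harmless, as no outcome has more than [n] coalitions. *)
Definition decide_hdg : bool :=
  anyb (minn (rh1 I) (nn I) + 1) (fun N1 => anyb (minn (rh2 I) (nn I) + 1) (fun N2 =>
    anyb (3 ^ cods) (fun s => stable_support s && (dig 2 (carries s N1 N2) 0 == 1)))).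

End Algorithm.

(** * The decision procedure obeys the bounds *)

Ltac fp_user := fail.
Ltac fp_atom := match goal with
  | |- FP _ snd => first [exact: FP_var | exact: (FP_false (FP_var _ _))]
  | |- FP _ (fun e => e.2) => first [exact: FP_var | exact: (FP_false (FP_var _ _))]
  | |- FP _ (fun e => e.1.2) => first [exact: (FP_wk _ (FP_var _ _)) | exact: (FP_false (FP_wk _ (FP_var _ _)))]
  | |- FP _ (fun e => e.1.1.2) => first [exact: (FP_wk _ (FP_wk _ (FP_var _ _)))
     | exact: (FP_false (FP_wk _ (FP_wk _ (FP_var _ _))))]
  | h : FP _ ?F |- FP _ ?F => first [exact: h | exact: (FP_false h) | exact: (FP_weak _ h)]
  | h : FP _ ?F |- FP _ (fun e => ?F e) =>
     first [exact: h | exact: (FP_false h) | exact: (FP_weak _ h)]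
  | h : FP _ ?F |- FP _ (fun e => ?F e.1) => first [exact: (FP_wk _ h)
     | exact: (FP_false (FP_wk _ h)) | exact: (FP_weak _ (FP_wk _ h))]
  | h : FP _ ?F |- FP _ (fun e => ?F e.1.1) => first [exact: (FP_wk _ (FP_wk _ h))
     | exact: (FP_false (FP_wk _ (FP_wk _ h))) | exact: (FP_weak _ (FP_wk _ (FP_wk _ h)))]
  | h : FP _ ?F |- FP _ (fun e => ?F e.1.1.1) => first [exact: (FP_wk _ (FP_wk _ (FP_wk _ h)))
     | exact: (FP_false (FP_wk _ (FP_wk _ (FP_wk _ h))))]
  | h : FP _ _ |- _ => exact: h
  end.
(** Follows the syntax of the expression. Sums and existential quantifiers are first tried with a
    range bounded in the parameters, then with one polynomial in [n]; [fp_user] is redefined as more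
    definitions become available. *)
Ltac fp := lazy beta; lazymatch goal with
  | |- FP _ (fun _ => ?x) => exact: FP_cst
  | |- FP _ (fun e => nn _) => exact: FP_n
  | |- FP _ (fun e => gm _) => exact: FP_gm
  | |- FP _ (fun e => sg _) => exact: FP_sg
  | |- FP _ (fun e => cl _ _) => apply: FP_col; fp
  | |- FP _ (fun e => S _) => apply: FP_S; fp
  | |- FP _ (fun e => nat_of_bool (_ && _)) => apply: FP_andb; fp
  | |- FP _ (fun e => nat_of_bool (_ || _)) => apply: FP_orb; fp
  | |- FP _ (fun e => nat_of_bool (_ ==> _)) => apply: FP_implyb; fp
  | |- FP _ (fun e => nat_of_bool (~~ _)) => apply: FP_negb; fp
  | |- FP _ (fun e => nat_of_bool (_ <= _)) => apply: FP_leq; fp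
  | |- FP _ (fun e => nat_of_bool (_ == _)) => apply: FP_eqn; fp
  | |- FP _ (fun e => if _ then _ else _) => apply: FP_if; fp
  | |- FP _ (fun e => _ + _) => apply: FP_add; fp
  | |- FP _ (fun e => _ * _) => apply: FP_mul; fp
  | |- FP _ (fun e => _ - _) => apply: FP_sub; fp
  | |- FP _ (fun e => _ ^ _) => first [apply: FP_pow | apply: FP_weak; apply: FP_pow]; fp
  | |- FP _ (fun e => dig _ _ _) => apply: FP_dig; fp
  | |- FP _ (fun e => shiftr _ _) => apply: FP_shiftr; fp
  | |- FP _ (fun e => _ %% _) => apply: FP_mod; fp
  | |- FP _ (fun e => _ %/ _) => apply: FP_div; fp
  | |- FP _ (fun e => nat_of_bool (anyb _ _)) =>
      first [apply: FP_anyT; [solve [fp]|] | apply: FP_anyF; [solve [fp]|]]; fp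
  | |- FP _ (fun e => nat_of_bool (allb _ _)) => apply: FP_allT; [fp|fp]
  | |- FP _ (fun e => sumI _ _) =>
      first [apply: FP_sumT; [solve [fp]|] | apply: FP_sumF; [solve [fp]|]]; fp
  | _ => first [fp_user | fp_atom]
  end.

Lemma FP_dcodes G b : FP b (fun e : env G => dcodes (ins e)).
Proof. rewrite /dcodes. fp. Qed.
Ltac fp_user ::= lazymatch goal with
  | |- FP _ (fun e => dcodes _) => exact: FP_dcodes
  end.

Lemma FP_rank G (A : env G -> nat) : FP false A -> FP false (fun e => rank (ins e) (A e)).
Proof. move=> h; rewrite /rank; fp. Qed.

Lemma FP_sample G b (d A : env G -> nat) : FP true d -> FP false A ->
  FP b (fun e => sample (ins e) (d e) (A e) : nat).
Proof.
move=> h1 h2; rewrite /sample; have h3 := FP_rank h2; fp.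
Qed.

Lemma FP_asks G b (A d d' : env G -> nat) : FP false A -> FP true d -> FP true d' ->
  FP b (fun e => asks (ins e) (A e) (d e) (d' e) : nat).
Proof.
move=> h1 h2 h3; rewrite /asks.
apply: (@FP_query _ _ A (fun e => sample (ins e) (d e)) (fun e => sample (ins e) (d' e))) => //.
  by apply: FP_sample; fp.
by apply: FP_sample; fp.
Qed.

Lemma FP_tables G b : FP b (fun e : env G => tables (ins e)).
Proof. rewrite /tables; fp. Qed.

Ltac fp_user ::= lazymatch goal with
  | |- FP _ (fun e => dcodes _) => exact: FP_dcodes
  | |- FP _ (fun e => tables _) => exact: FP_tables
  end.

Lemma FP_typ G b (A : env G -> nat) : FP false A -> FP b (fun e => typ (ins e) (A e)).
Proof.
move=> h; apply: FP_weak; rewrite /typ; apply: FP_add; first by fp.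
apply: FP_sumT; first by fp.
by apply: FP_mul; [fp|apply: FP_asks; fp].
Qed.

Lemma FP_types G b : FP b (fun e : env G => types (ins e)).
Proof. rewrite /types; fp. Qed.

Ltac fp_user ::= lazymatch goal with
  | |- FP _ (fun e => dcodes _) => exact: FP_dcodes
  | |- FP _ (fun e => tables _) => exact: FP_tables
  | |- FP _ (fun e => types _) => exact: FP_types
  end.

Lemma FP_prefers G b (t d d' : env G -> nat) : FP true t -> FP true d -> FP true d' ->
  FP b (fun e => prefers (ins e) (t e) (d e) (d' e) : nat).
Proof. move=> h1 h2 h3; rewrite /prefers; fp. Qed.

Lemma FP_supply G (t : env G -> nat) : FP true t -> FP false (fun e => supply (ins e) (t e)).
Proof.
move=> h; rewrite /supply; apply: FP_sumF; first by fp.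
by apply: FP_eqn; [apply: FP_typ; fp|fp].
Qed.

Lemma FP_cods G b : FP b (fun e : env G => cods (ins e)).
Proof. rewrite /cods; fp. Qed.

Ltac fp_user ::= lazymatch goal with
  | |- FP _ (fun e => dcodes _) => exact: FP_dcodes
  | |- FP _ (fun e => tables _) => exact: FP_tables
  | |- FP _ (fun e => types _) => exact: FP_types
  | |- FP _ (fun e => cods _) => exact: FP_cods
  | |- FP _ (fun e => nat_of_bool (prefers _ _ _ _)) => apply: FP_prefers; fp
  end.

Lemma FP_mult G b (V t : env G -> nat) : FP true V -> FP true t ->
  FP b (fun e => mult (ins e) (V e) (t e)).
Proof. move=> h1 h2; rewrite /mult; fp. Qed.

Lemma FP_weight G b (t : env G -> nat) : FP true t -> FP b (fun e => weight (ins e) (t e)).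
Proof. move=> h1; rewrite /weight; fp. Qed.

Ltac fp_user ::= lazymatch goal with
  | |- FP _ (fun e => dcodes _) => exact: FP_dcodes
  | |- FP _ (fun e => tables _) => exact: FP_tables
  | |- FP _ (fun e => types _) => exact: FP_types
  | |- FP _ (fun e => cods _) => exact: FP_cods
  | |- FP _ (fun e => nat_of_bool (prefers _ _ _ _)) => apply: FP_prefers; fp
  | |- FP _ (fun e => mult _ _ _) => apply: FP_mult; fp
  | |- FP _ (fun e => weight _ _) => apply: FP_weight; fp
  end.

Lemma FP_pal G b (V : env G -> nat) : FP true V -> FP b (fun e => pal (ins e) (V e)).
Proof. move=> h1; rewrite /pal; fp. Qed.

Lemma FP_csize G b (V : env G -> nat) : FP true V -> FP b (fun e => csize (ins e) (V e)).
Proof. move=> h1; rewrite /csize; fp. Qed.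

Ltac fp_user ::= lazymatch goal with
  | |- FP _ (fun e => dcodes _) => exact: FP_dcodes
  | |- FP _ (fun e => tables _) => exact: FP_tables
  | |- FP _ (fun e => types _) => exact: FP_types
  | |- FP _ (fun e => cods _) => exact: FP_cods
  | |- FP _ (fun e => nat_of_bool (prefers _ _ _ _)) => apply: FP_prefers; fp
  | |- FP _ (fun e => mult _ _ _) => apply: FP_mult; fp
  | |- FP _ (fun e => weight _ _) => apply: FP_weight; fp
  | |- FP _ (fun e => pal _ _) => apply: FP_pal; fp
  | |- FP _ (fun e => csize _ _) => apply: FP_csize; fp
  end.

Lemma FP_deviates G b ind (t U V : env G -> nat) : FP true t -> FP true U -> FP true V ->
  FP b (fun e => deviates ind (ins e) (t e) (U e) (V e) : nat).
Proof. move=> h1 h2 h3; rewrite /deviates. fp. Qed.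

Lemma FP_stable_support G b ind (s : env G -> nat) : FP true s ->
  FP b (fun e => stable_support ind (ins e) (s e) : nat).
Proof.
move=> h; rewrite /stable_support; apply: FP_andb; first by fp.
apply: FP_allT; first by fp.
lazy beta; apply: FP_implyb; first by fp.
apply: FP_andb; first by fp.
apply: FP_allT; first by fp.
lazy beta; apply: FP_implyb; first by fp.
apply: FP_allT; first by fp.
lazy beta; apply: FP_implyb; first by fp.
by apply: FP_negb; apply: FP_deviates; fp.
Qed.

Lemma FP_rows G b : FP b (fun e : env G => rows (ins e)).
Proof. rewrite /rows; fp. Qed.

Lemma FP_coef G b (r U : env G -> nat) : FP true r -> FP true U ->
  FP b (fun e => coef (ins e) (r e) (U e)).
Proof. move=> h1 h2; rewrite /coef; fp. Qed.

Lemma FP_rhs G (N1 N2 r : env G -> nat) : FP false N1 -> FP false N2 -> FP true r ->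
  FP false (fun e => rhs (ins e) (N1 e) (N2 e) (r e)).
Proof. move=> h1 h2 h3; rewrite /rhs; have h4 := FP_supply h3; fp. Qed.

Lemma FP_cbase G b : FP b (fun e : env G => cbase (ins e)).
Proof. rewrite /cbase; fp. Qed.

Ltac fp_user ::= lazymatch goal with
  | |- FP _ (fun e => types _) => exact: FP_types
  | |- FP _ (fun e => cods _) => exact: FP_cods
  | |- FP _ (fun e => rows _) => exact: FP_rows
  | |- FP _ (fun e => cbase _) => exact: FP_cbase
  | |- FP _ (fun e => coef _ _ _) => apply: FP_coef; fp
  end.

Lemma FP_carry0 G b (s : env G -> nat) : FP true s -> FP b (fun e => carry0 (ins e) (s e)).
Proof. move=> h; apply: FP_weak; rewrite /carry0; fp. Qed.

Lemma FP_carry_ok G b (s N1 N2 k c' c y : env G -> nat) : FP true s -> FP false N1 ->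
  FP false N2 -> FP false k -> FP true c' -> FP true c -> FP true y ->
  FP b (fun e => carry_ok (ins e) (s e) (N1 e) (N2 e) (k e) (c' e) (c e) (y e) : nat).
Proof.
move=> h1 h2 h3 h4 h5 h6 h7; rewrite /carry_ok.
apply: FP_andb; first by fp.
apply: FP_allT; first by fp.
lazy beta; apply: FP_eqn; last by fp.
apply: FP_add; first by fp.
by apply: FP_mod; last fp; apply: FP_shiftr; last fp; apply: FP_rhs; fp.
Qed.

Lemma FP_carry_next G (s N1 N2 k mask : env G -> nat) : FP true s -> FP false N1 ->
  FP false N2 -> FP false k -> FP true mask ->
  FP true (fun e => carry_next (ins e) (s e) (N1 e) (N2 e) (k e) (mask e)).
Proof.
move=> h1 h2 h3 h4 h5; rewrite /carry_next.
apply: FP_sumT; first by fp.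
lazy beta; apply: FP_mul; first by fp.
apply: FP_anyT; first by fp.
lazy beta; apply: FP_andb; first by fp.
apply: FP_anyT; first by fp.
by apply: FP_carry_ok; fp.
Qed.

Lemma FP_carries G (s N1 N2 : env G -> nat) : FP true s -> FP false N1 -> FP false N2 ->
  FP true (fun e => carries (ins e) (s e) (N1 e) (N2 e)).
Proof.
move=> h1 h2 h3; rewrite /carries.
have h4 := FP_carry0 true h1.
(* The uniform bound is the mask in which every carry code is marked. *)
apply: (@FP_iteriF _ _ (fun e => carry_next (ins e) (s e) (N1 e) (N2 e)) _
  (fun e => sumI (cbase (ins e) ^ rows (ins e)) (fun c' => 2 ^ c'))).
- by fp.
- by fp.
- by fp.
- by apply: FP_carry_next; fp.
by move=> e i x; apply: sumI_le => j _; case: anyb; rewrite ?muln1 ?muln0.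
Qed.

Lemma FP_decide_hdg ind : FP true (fun I : env [::] => decide_hdg ind (ins I) : nat).
Proof.
rewrite /decide_hdg.
apply: FP_anyF; first by apply: FP_add; [exact: FP_r1|fp].
apply: FP_anyF; first by apply: FP_add; [exact: (FP_wk _ (FP_r2 _))|fp].
apply: FP_anyT; first by fp.
apply: FP_andb; first by apply: FP_stable_support; fp.
lazy beta; apply: FP_eqn; last by fp.
by apply: FP_dig; [fp|apply: FP_weak; apply: FP_carries; fp|fp].
Qed.

(** * The machine from start to halt *)

Definition initial I (m : nat -> nat) :=
  [/\ m 0 = nn I, m 1 = gm I, m 2 = sg I, m 3 = rh1 I & m 4 = rh2 I] /\
  ((forall j, j < nn I -> m (5 + j) = cl I j) /\ (forall a, 5 + nn I <= a -> m a = 0)).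

(* Only the addresses above 5 + n are known to be free at the start, and g + 8 n
   is the first such address one can compute without losing g or n.  The colours
   are moved beyond it in order to free all low registers. *)
Definition prelude W Y := [:: IJz 0 Y;
  IAdd 1 1 0; IAdd 1 1 0; IAdd 1 1 0; IAdd 1 1 0; IAdd 1 1 0; IAdd 1 1 0; IAdd 1 1 0; IAdd 1 1 0;
  IStore 1 2; IConst 2 1; IAdd 1 1 2; IStore 1 3; IAdd 1 1 2; IStore 1 4; IAdd 1 1 2;
  IConst 4 3; ISub 3 1 4;
  ISub 3 3 0; ISub 3 3 0; ISub 3 3 0; ISub 3 3 0; ISub 3 3 0; ISub 3 3 0; ISub 3 3 0; ISub 3 3 0;
  IStore 1 3; IConst 4 (W + 1); IAdd 1 1 4; IConst 4 0; IAdd 3 0 4; IConst 0 5;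
  IJz 3 40; ILoad 4 0; IStore 1 4; IAdd 0 0 2; IAdd 1 1 2; ISub 3 3 2; IConst 4 0; IJz 4 32;
  IConst 2 5; ISub 0 0 2; IConst 2 1; IAdd 6 1 2; ISub 5 1 0; IConst 7 (W + 4); ISub 7 5 7;
  IConst 8 1; ILoad 2 7; IAdd 7 7 8; ILoad 3 7; IAdd 7 7 8; ILoad 4 7; IAdd 7 7 8; ILoad 1 7].

Section Prelude.
Variables (P : program) (W Y : nat) (I : inst).
Hypotheses (hP : placed P 0 (prelude W Y)) (hI : wfI I) (hn : 0 < nn I) (hg : 0 < gm I).
Variable A : nat.
Hypothesis hA : A = gm I + 8 * nn I.

Definition saved (m : nat -> nat) :=
  [/\ m A = sg I, m (A + 1) = rh1 I, m (A + 2) = rh2 I & m (A + 3) = gm I].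

Lemma prelude_save m q B Q : initial I m ->
  (forall m', saved m' -> [/\ m' 0 = 5, m' 1 = A + W + 4, m' 2 = 1 & m' 3 = nn I] ->
    (forall j, j < nn I -> m' (5 + j) = cl I j) -> m' (A + W + 4 + nn I) = 0 ->
    wp P (orc I) 32 m' q B Q) ->
  wp P (orc I) 0 m q (32 + B) Q.
Proof.
move=> [[e0 e1 e2 e3 e4] [e5 e6]] hQ.
case: hP => h0 [h1 [h2 [h3 [h4 [h5 [h6 [h7 [h8 [h9 [h10 [h11 [h12 [h13 [h14 [h15 [h16 [h17 [h18
 [h19 [h20 [h21 [h22 [h23 [h24 [h25 [h26 [h27 [h28 [h29 [h30 [h31 _]]]]]]]]]]]]]]]]]]]]]]]]]]]]]]].
rewrite -[32 + B]/(B.+4.+4.+4.+4.+4.+4.+4.+4).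
apply: (wp_jzS h0); first by lia.
apply: (wp_add h1); apply: (wp_add h2); apply: (wp_add h3); apply: (wp_add h4).
apply: (wp_add h5); apply: (wp_add h6); apply: (wp_add h7); apply: (wp_add h8).
set m1 := upd _ _ _.
have f1 : m1 1 = A by rewrite /m1; ups; rewrite e0 e1 hA; lia.
have g1 a : a != 1 -> m1 a = m a by move=> ha; rewrite /m1; ups.
clearbody m1.
apply: (wp_store h9); apply: (wp_const h10); apply: (wp_add h11); apply: (wp_store h12).
apply: (wp_add h13); apply: (wp_store h14); apply: (wp_add h15).
ups; rewrite !f1; ups; rewrite ?f1.
(* Since [n] and [g] are positive, the save area lies above all registers that the prelude works
   with. *)
have hA9 : 8 < A by lia.
set m2 := upd _ 1 _.
have f2 : [/\ m2 A = sg I, m2 (A + 1) = rh1 I, m2 (A + 2) = rh2 I, m2 1 = A + 3 & m2 2 = 1].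
  by rewrite /m2; split; ups; rewrite ?g1 ?e2 ?e3 ?e4 -?addnA.
have g2 a : ~~ (A <= a <= A + 2) -> 2 < a \/ a = 0 -> m2 a = m a.
  by move=> ha hb; rewrite /m2; ups; rewrite g1 //; lia.
clearbody m2; case: f2 => k1 k2 k3 k4 k5.
apply: (wp_const h16); apply: (wp_sub h17).
apply: (wp_sub h18); apply: (wp_sub h19); apply: (wp_sub h20); apply: (wp_sub h21).
apply: (wp_sub h22); apply: (wp_sub h23); apply: (wp_sub h24); apply: (wp_sub h25).
set m3 := upd _ _ _.
have f3 : m3 3 = gm I by rewrite /m3; ups; rewrite k4 g2 ?e0; lia.
have g3 a : a != 3 -> a != 4 -> m3 a = m2 a by move=> ha hb; rewrite /m3; ups.
clearbody m3.
apply: (wp_store h26); apply: (wp_const h27); apply: (wp_add h28); apply: (wp_const h29).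
apply: (wp_add h30); apply: (wp_const h31).
rewrite g3 // k4 f3.
apply: hQ.
- by split; ups; rewrite ?g3 ?k1 ?k2 ?k3; lia.
- by split; ups; rewrite ?g3 ?k4 ?k5 ?g2 ?e0; lia.
- by move=> j hj; ups; rewrite g3 ?g2 ?e5; lia.
- by ups; rewrite g3 ?g2 ?e6; lia.
Qed.

(** [r] colours remain to be copied. The cell after the destination is still 0, which provides the
    colour of the non-agent [n] that [inv] demands. *)
Lemma prelude_move m q B Q r : saved m ->
  [/\ m 0 = 5 + (nn I - r), m 1 = A + W + 4 + (nn I - r), m 2 = 1 & m 3 = r] -> r <= nn I ->
  (forall j, j < nn I -> m (5 + j) = cl I j) -> m (A + W + 4 + nn I) = 0 ->
  (forall j, j < nn I - r -> m (A + W + 4 + j) = cl I j) ->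
  (forall m', saved m' -> m' 0 = 5 + nn I -> m' 1 = A + W + 4 + nn I ->
    (forall j, j <= nn I -> m' (A + W + 4 + j) = cl I j) ->
    wp P (orc I) 40 m' q B Q) ->
  wp P (orc I) 32 m q (8 * r + 1 + B) Q.
Proof.
have hA9 : 8 < A by lia.
have hAn : 5 + nn I < A by lia.
move=> hs e hr h5 hz hc hQ.
have [h32 [h33 [h34 [h35 [h36 [h37 [h38 [h39 _]]]]]]]] : placed P 32 (drop 32 (prelude W Y)).
  by move: hP; rewrite -{1}(cat_take_drop 32 (prelude W Y)) => /placed_cat[].
elim: r m hs e hr h5 hz hc => [|r IH] m [s1 s2 s3 s4] [e0 e1 e2 e3] hr h5 hz hc.
  rewrite muln0 add0n addnC addn1; apply: (wp_jz0 h32 e3).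
  rewrite subn0 in e0 e1 hc.
  apply: hQ => // j; rewrite leq_eqVlt => /orP[/eqP->|]; last exact: hc.
  by rewrite hz; case: hI => _ ->.
have -> : 8 * r.+1 + 1 + B = (8 * r + 1 + B).+4.+4 by lia.
apply: (wp_jzS h32); first by rewrite e3.
apply: (wp_load h33); apply: (wp_store h34); apply: (wp_add h35); apply: (wp_add h36).
apply: (wp_sub h37); apply: (wp_const h38); apply: (wp_jz0 h39); first by ups.
rewrite ![upd m 4 _ 1]upd_neq // e1 e0 h5; last by lia.
apply: IH.
- by split; ups.
- by split; ups; rewrite ?e0 ?e1 ?e2 ?e3; lia.
- lia.
- by move=> j hj; ups; rewrite h5.
- by ups.
- move=> j hj; case: (ltngtP j (nn I - r.+1)) => hj2; first by ups; rewrite hc.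
    by lia.
  by rewrite hj2; ups.
Qed.

Lemma prelude_correct m q B Q : initial I m ->
  (forall m', inv W I m' -> wp P (orc I) 55 m' q B Q) ->
  wp P (orc I) 0 m q (32 + (8 * nn I + 1 + (15 + B))) Q.
Proof.
have hA9 : 8 < A by lia.
move=> hm hQ; apply: prelude_save hm _ => m1 hs [e0 e1 e2 e3] h5 hz.
apply: prelude_move => //; rewrite ?subnn ?addn0 //.
move=> {e0 e1 e2 e3 h5 hz hs m1} m1 [s1 s2 s3 s4] e0 e1 hc.
have [h0 [h1 [h2 [h3 [h4 [h5 [h6 [h7 [h8 [h9 [h10 [h11 [h12 [h13 [h14 _]]]]]]]]]]]]]]] :
    placed P 40 (drop 40 (prelude W Y)).
  by move: hP; rewrite -{1}(cat_take_drop 40 (prelude W Y)) => /placed_cat[].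
rewrite -[15 + B]/(B.+4.+4.+4.+3).
apply: (wp_const h0); apply: (wp_sub h1); apply: (wp_const h2); apply: (wp_add h3).
apply: (wp_sub h4); apply: (wp_const h5); apply: (wp_sub h6).
set m2 := upd _ 7 _.
have f5 : m2 5 = A + W + 4 by rewrite /m2; ups; rewrite e0 e1; lia.
have f6 : m2 6 = A + W + 4 + nn I + 1 by rewrite /m2; ups; rewrite e1; lia.
have f0 : m2 0 = nn I by rewrite /m2; ups; rewrite e0; lia.
have f7 : m2 7 = A by rewrite /m2; ups; rewrite e0 e1; lia.
have g2 a : 7 < a -> m2 a = m1 a by move=> ha; rewrite /m2; ups.
clearbody m2.
have u7 mm v : (upd mm 8 v 7 = mm 7) * (upd mm 2 v 7 = mm 7) * (upd mm 3 v 7 = mm 7) *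
  (upd mm 4 v 7 = mm 7) by rewrite !upd_neq.
apply: (wp_const h7); apply: (wp_load h8); rewrite u7 f7; ups.
apply: (wp_add h9); apply: (wp_load h10); rewrite upd_eq !u7 f7; ups.
apply: (wp_add h11); apply: (wp_load h12); rewrite upd_eq !(u7, upd_eq); ups.
apply: (wp_add h13); apply: (wp_load h14); rewrite upd_eq !(u7, upd_eq); ups.
have [n2 n3] : A + 1 + 1 = A + 2 /\ A + 1 + 1 + 1 = A + 3 by lia.
rewrite n3 n2 !g2; try lia.
rewrite s1 s2 s3 s4.
apply: hQ; split.
  by split; ups.
by split; ups; rewrite ?f5 ?f6; [lia|lia|move=> j hj; ups; rewrite g2 ?hc; lia].
Qed.

End Prelude.

Definition tower_prog c : program := [:: IConst 1 c; IAdd 0 0 1; IConst 1 1; IConst 2 1;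
  IJz 0 15; IConst 3 1;
  IJz 1 11; IAdd 3 3 3; ISub 1 1 2; IConst 4 0; IJz 4 6;
  IConst 4 0; IAdd 1 3 4; ISub 0 0 2; IJz 4 4;
  IConst 4 0; IAdd 0 1 4].

Lemma tower_computable c : ram_computable (fun k => tw (k + c)).
Proof.
exists (tower_prog c) => k; set P := tower_prog c; set O := no_oracle.
have hf p : p < 17 -> fetch P p (nth (IJz 0 0) P p) by [].
have inner x m q Q : m 1 = x -> m 2 = 1 ->
    (forall m', m' 0 = m 0 -> m' 2 = 1 -> m' 3 = m 3 * 2 ^ x -> exists B, wp P O 11 m' q B Q) ->
    exists B, wp P O 6 m q B Q.
  elim: x m => [|x IH] m e1 e2 hQ.
    have [B hB] : exists B, wp P O 11 m q B Q by apply: hQ; rewrite ?muln1.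
    by exists B.+1; apply: (wp_jz0 (hf 6 _)).
  have [B hB] : exists B, wp P O 6 (upd (upd (upd m 3 (m 3 + m 3)) 1 x) 4 0) q B Q.
    apply: IH => // m' f0 f2 f3; apply: hQ => //.
    by rewrite f3 /=; ups; rewrite addnn -mul2n expnS mulnCA mulnA.
  exists B.+4.+1; apply: (wp_jzS (hf 6 _)); rewrite ?e1 //.
  apply: (wp_add (hf 7 _)) => //; apply: (wp_sub (hf 8 _)) => //.
  apply: (wp_const (hf 9 _)) => //; apply: (wp_jz0 (hf 10 _)) => //.
  by move: hB; ups; rewrite e1 e2 subn1.
have outer j d m : m 0 = j -> m 1 = tw d -> m 2 = 1 ->
    exists B, wp P O 4 m 17 B (fun m' => m' 0 = tw (j + d)).
  elim: j d m => [|j IH] d m e0 e1 e2.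
    exists 3; apply: (wp_jz0 (hf 4 _)) => //; apply: (wp_const (hf 15 _)) => //.
    apply: (wp_add (hf 16 _)) => //; apply: wp_done => //.
    by ups; rewrite addn0 e1.
  have [B hB] : exists B, wp P O 6 (upd m 3 1) 17 B (fun m' => m' 0 = tw (j.+1 + d)).
    apply: (inner (tw d)) => // m' f0 f2; rewrite upd_eq mul1n => f3.
    rewrite upd_neq // in f0.
    have [B hB] : exists B, wp P O 4 (upd (upd (upd m' 4 0) 1 (m' 3 + 0)) 0 j) 17 B
        (fun m' => m' 0 = tw (j + d.+1)).
      by apply: IH => //; ups; rewrite addn0.
    exists B.+4; apply: (wp_const (hf 11 _)) => //; apply: (wp_add (hf 12 _)) => //.
    apply: (wp_sub (hf 13 _)) => //; apply: (wp_jz0 (hf 14 _)) => //.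
    by move: hB; ups; rewrite f0 e0 f2 subn1 addnS addSn.
  by exists B.+2; apply: (wp_jzS (hf 4 _)); rewrite ?e0 //; apply: (wp_const (hf 5 _)).
have [B hB] : exists B, wp P O 4 (upd (upd (upd (upd (upd (fun=> 0) 0 k) 1 c) 0 (k + c)) 1 1) 2 1)
    17 B (fun m' => m' 0 = tw (k + c + 0)).
  by apply: outer; ups.
have [m' [[T hT hr] h]] : wp P O 0 (upd (fun=> 0) 0 k) 17 B.+4 (fun m' => m' 0 = tw (k + c)).
  apply: (wp_const (hf 0 _)) => //; apply: (wp_add (hf 1 _)) => //.
  apply: (wp_const (hf 2 _)) => //; apply: (wp_const (hf 3 _)) => //.
  by move: hB; ups; rewrite addn0.
by exists T; rewrite /= hr.
Qed.

Lemma run_halted P O cfg T T' : halted P (run P O cfg T) -> T <= T' ->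
  run P O cfg T' = run P O cfg T.
Proof.
move=> h /subnKC <-; elim: (T' - T) => [|d IH]; first by rewrite addn0.
rewrite addnS /run iterS -!/(run _ _ _ _) IH; case: (run _ _ _ _) h => pc m.
by rewrite /halted /step /= => ->.
Qed.

Lemma halting_program (F : env [::] -> nat) : CP F -> exists P c, forall I m,
  initial I m -> wfI I -> (0 < nn I -> 0 < gm I) ->
  wp P (orc I) 0 m (size P) (bnd false c I) (fun m' => m' 0 = if nn I == 0 then 1 else F I).
Proof.
move=> [code [w hC]]; have [c {}hC] := hC 0.
pose W := w + 9.
pose main := code [::] 55 7.
(* The address of the instruction that outputs 1. Without agents the prelude, of length 55, jumps
   there at once; otherwise the jump before it skips it. *)
pose Y := 55 + size main + 3.
pose P := prelude W Y ++ main ++ [:: IConst 8 0; IAdd 0 7 8; IJz 8 Y.+1; IConst 0 1].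
have [cc hd] : dom false (fun I => 32 + (8 * nn I + 1 + (15 + (bnd false c I + 3)))).
  apply: dom_add; first by dom.
  apply: dom_add; last by dom.
  apply: dom_add; last by dom.
  apply: dom_mul; first by dom.
  by exists 1 => I; rewrite /bnd expn1; have := tw_gt0 (gm I + sg I + 1); nia.
exists P, cc => I m hm hI hg.
have hsz : size P = Y.+1 by rewrite /P !size_cat /= /Y; lia.
have h0 : placed P 0 (prelude W Y) by have := placed_mid [::] (prelude W Y) (main ++ _); apply.
have /placed_cat[h1 [h2 [h3 [h4 [h5 _]]]]] :
    placed P 55 (main ++ [:: IConst 8 0; IAdd 0 7 8; IJz 8 Y.+1; IConst 0 1]).
  have := placed_mid (prelude W Y) (main ++ [:: IConst 8 0; IAdd 0 7 8; IJz 8 Y.+1; IConst 0 1]) [::].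
  by rewrite cats0.
apply: (wp_le _ (hd _)); case: eqP => [n0|/eqP n0].
  apply: (wp_le (B1 := 2)); last by lia.
  case: h0 => h0 _; apply: (wp_jz0 h0); first by case: hm => -[-> _].
  have -> : Y = (55 + size main).+3 by rewrite /Y; lia.
  by apply: (wp_const h5); apply: wp_done => //; rewrite hsz /Y; lia.
have hn : 0 < nn I by lia.
apply: (prelude_correct h0 hI hn (hg hn) erefl hm) => m' hinv.
apply: wp_seq.
  by apply: (hC I hI P [::] 55 7 m' W h1 hinv) => //; rewrite /W; lia.
move=> m2 [e7 _]; apply: (wp_const h2); apply: (wp_add h3); apply: (wp_jz0 h4) => //.
by apply: wp_done; [ups; rewrite addn0|rewrite hsz].
Qed.

Definition game_inst n gam (col : 'I_n -> 'I_gam) (pref : 'I_n -> rel (palette_t gam))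
    sigma rho1 rho2 :=
  Inst n gam sigma rho1 rho2 (col_nat col) (game_oracle col pref).

Lemma col_nat_ord n gam (col : 'I_n -> 'I_gam) (i : 'I_n) : col_nat col i = col i.
Proof. by rewrite /col_nat valK. Qed.

Lemma col_nat_ge n gam (col : 'I_n -> 'I_gam) j : n <= j -> col_nat col j = 0.
Proof. by move=> h; rewrite /col_nat insubN // -leqNgt. Qed.

Lemma col_nat_le n gam (col : 'I_n -> 'I_gam) j : col_nat col j <= gam.
Proof. by rewrite /col_nat; case: insubP => // i _ _; apply: ltnW; apply: ltn_ord. Qed.

Lemma fpt_of_decision (stable : stability_notion) ind :
  (forall n gam (col : 'I_n -> 'I_gam) (pref : 'I_n -> rel (palette_t gam)) sigma rho1 rho2,
    0 < n -> valid_game col pref ->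
    decide_hdg ind (game_inst col pref sigma rho1 rho2) <->
      hdg_yes stable col pref sigma rho1 rho2) ->
  (forall gam (col : 'I_0 -> 'I_gam) pref Pi, stable 0 gam col pref Pi) ->
  fpt_gamma_sigma stable.
Proof.
move=> hdec h0; have [P [c hP]] := halting_program (FP_decide_hdg ind).2.
(* With this function and exponent, the allotted time is [bnd false c] itself. *)
exists P, (fun k => tw (k + c)), c; split; first exact: tower_computable.
move=> n gam col pref sigma rho1 rho2 hv cfg.
pose I := game_inst col pref sigma rho1 rho2.
have [m' [[T hT hr] hm]] : wp P (orc I) 0 (init_mem col sigma rho1 rho2) (size P) (bnd false c I)
    (fun m' => m' 0 = if nn I == 0 then 1 else decide_hdg ind I).
  apply: (hP I).
  - have e a : 5 <= a -> init_mem col sigma rho1 rho2 a =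
        if 5 <= a < 5 + n then col_nat col (a - 5) else 0.
      by case: a => [|[|[|[|[|a]]]]].
    split; first by []; split=> [j hj|a ha].
      by rewrite e leq_addr // addKn ltn_add2l hj.
    rewrite e; first by rewrite [a < _]ltnNge ha andbF.
    exact: leq_trans (leq_addr _ _) ha.
  - by split=> j; [apply: col_nat_le|apply: col_nat_ge].
  - move=> /= hn; exact: leq_ltn_trans (ltn_ord (col (Ordinal hn))).
have hrun : cfg = (size P, m').
  rewrite /cfg -hr; apply: run_halted; first by rewrite hr /halted /=.
  by rewrite addn1.
rewrite hrun; split; first by rewrite /halted /=.
rewrite [_.2 0]hm /=; case: (n =P 0) => [n0|/eqP n0].
  (* Without agents the empty partition is an outcome, so the fixed answer 1 is right. *)
  split=> // _; subst n.
  exists set0; split; last first.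
    rewrite cards0; do !split=> //; last by move=> C; rewrite inE.
    by rewrite (_ : [set _ in _ | _] = set0) ?cards0 //; apply/setP => C; rewrite !inE.
  apply/and3P; split; last by rewrite inE.
    by rewrite /cover big_set0; apply/eqP/setP => -[].
  by apply/trivIsetP => A B; rewrite inE.
rewrite -hdec //; last by rewrite lt0n.
by rewrite eqb0 negbK.
Qed.

(** * Correctness of the carry dynamic programme *)

Lemma dig0 B x : dig B x 0 = x %% B.
Proof. by rewrite /dig expn0 divn1. Qed.

Lemma digS B x j : dig B x j.+1 = dig B (x %/ B) j.
Proof. by rewrite /dig expnS divnMA. Qed.

Lemma dig_lt B x j : 0 < B -> dig B x j < B.
Proof. by move=> hB; rewrite ltn_pmod. Qed.

Lemma digits_recl B R (d : nat -> nat) : \sum_(i < R.+1) B ^ i * d i = d 0 + B * \sum_(i < R) B ^ i * d i.+1.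
Proof.
rewrite big_ord_recl mul1n big_distrr /=; congr (_ + _).
by apply: eq_bigr => i _; rewrite /bump add1n expnS mulnA.
Qed.

Lemma dig_sum B R (d : nat -> nat) j : (forall i, i < R -> d i < B) -> j < R ->
  dig B (\sum_(i < R) B ^ i * d i) j = d j.
Proof.
elim: R d j => // R IH d [|j] hd hj; rewrite digits_recl.
  by rewrite dig0 addnC mulnC modnMDl modn_small ?hd.
have hB : 0 < B by apply: leq_ltn_trans (hd 0 _).
rewrite digS mulnC addnC divnMDl // divn_small ?hd // addn0.
by apply: (IH (fun i => d i.+1)) => // i hi; apply: hd.
Qed.

Lemma digits_lt B R (d : nat -> nat) : 0 < B -> (forall i, i < R -> d i < B) -> \sum_(i < R) B ^ i * d i < B ^ R.
Proof.
move=> hB; elim: R d => [|R IH] d hd; first by rewrite big_ord0.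
rewrite digits_recl expnS.
have h1 := hd 0 isT; have h2 := IH (fun i => d i.+1) (fun i hi => hd i.+1 hi).
by apply: (@leq_trans (B * (\sum_(i < R) B ^ i * d i.+1).+1)); [rewrite mulnS; lia|rewrite leq_mul2l h2 orbT].
Qed.

Lemma digits_dig B R x : x < B ^ R -> x = \sum_(i < R) B ^ i * dig B x i.
Proof.
elim: R x => [|R IH] x; first by rewrite big_ord0 expn0; case: x.
rewrite digits_recl dig0 => hx. 
have {1}-> : x = x %% B + B * (x %/ B) by rewrite mulnC addnC -divn_eq.
congr (_ + _ * _).
have hB : 0 < B by case: B hx {IH} => [|B' _] //; rewrite exp0n.
rewrite [LHS](IH (x %/ B)); last by rewrite ltn_divLR // -expnSr.
by apply: eq_bigr => i _; rewrite digS.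
Qed.

Lemma eq_digits B R x y : x < B ^ R -> y < B ^ R -> (forall i, i < R -> dig B x i = dig B y i) ->
  x = y.
Proof.
move=> hx hy h; rewrite (digits_dig hx) (digits_dig hy).
by apply: eq_bigr => i _; rewrite h.
Qed.

Lemma dig_mask N (p : nat -> bool) c : c < N ->
  dig 2 (\sum_(i < N) 2 ^ i * p i) c = p c.
Proof. by apply: (@dig_sum _ _ (fun i => p i : nat)) => i _; case: (p i). Qed.

Lemma dig_exp2 a c : dig 2 (2 ^ a) c = (c == a).
Proof.
have -> : 2 ^ a = \sum_(i < a.+1 + c) 2 ^ i * (i == a :> nat).
  have h : a < a.+1 + c by lia.
  rewrite (bigD1 (Ordinal h)) //= eqxx muln1 big1 ?addn0 // => i.
  by rewrite -val_eqE /= => /negPf ->; rewrite muln0.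
by rewrite (@dig_mask _ (eq_op^~ a)) //; lia.
Qed.

Lemma shiftrE x k : shiftr x k = x %/ 2 ^ k.
Proof.
elim: k => [|k IH]; first by rewrite expn0 divn1.
by rewrite /shiftr /= -/(shiftr x k) IH -divnMA -expnSr.
Qed.

Lemma modn_exp2S b k : b %% 2 ^ k.+1 = 2 ^ k * (b %/ 2 ^ k %% 2) + b %% 2 ^ k.
Proof.
rewrite {1}(divn_eq b (2 ^ k)) {1}(divn_eq (b %/ 2 ^ k) 2) mulnDl -mulnA -expnS -addnA modnMDl.
rewrite modn_small [_ * 2 ^ k]mulnC //.
have h1 : b %/ 2 ^ k %% 2 < 2 by rewrite ltn_pmod.
have h2 : b %% 2 ^ k < 2 ^ k by rewrite ltn_pmod ?expn_gt0.
rewrite expnS; nia.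
Qed.

Section Carries.
Variables (I : inst) (s N1 N2 : nat).
Hypotheses (hN1 : N1 <= nn I) (hN2 : N2 <= nn I).
Local Notation T := (cods I).
Local Notation B := (cbase I).
Local Notation R := (rows I).
Local Notation a := (coef I).
Local Notation b := (rhs I N1 N2).

Definition lhs (z : nat -> nat) r := \sum_(U < T) a r U * z U.

Lemma lhsD z z' r : lhs (fun U => z U + z' U) r = lhs z r + lhs z' r.
Proof. by rewrite /lhs -big_split; apply: eq_bigr => U _; rewrite mulnDr. Qed.

Lemma lhsZ x z r : lhs (fun U => x * z U) r = x * lhs z r.
Proof. by rewrite /lhs big_distrr; apply: eq_bigr => U _; rewrite mulnCA. Qed.

Lemma eq_lhs z z' r : (forall U, U < T -> z U = z' U) -> lhs z r = lhs z' r.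
Proof. by move=> h; apply: eq_bigr => U _; rewrite h. Qed.

Lemma coef_le r U : a r U <= sg I + 1.
Proof.
rewrite /coef; case: ifP => _; first by apply: ltnW; apply: dig_lt; rewrite addn1.
by case: ifP => _; apply: leq_trans (leq_b1 _) _; rewrite addn1.
Qed.

Lemma lhs_le z x r : (forall U, U < T -> z U <= x) -> lhs z r <= T * (sg I + 1) * x.
Proof.
move=> h; apply: (@leq_trans (\sum_(U < T) (sg I + 1) * x)).
  by apply: leq_sum => U _; apply: leq_mul; [exact: coef_le|exact: h].
by rewrite sum_nat_const card_ord mulnA.
Qed.

Local Notation S := (dig 3 s).

(** The meaning of a carry: some excess of [k] bits matches the low [k] bits of every right-hand
    side, and [c] records the surplus in units of [2 ^ k]. *)
Definition reach k (c : nat) := exists y : nat -> nat,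
  (forall U, U < T -> y U < 2 ^ k) /\ (forall U, U < T -> 0 < y U -> S U = 2) /\
  (forall r, r < R -> 2 ^ k * dig B c r + b r %% 2 ^ k = lhs S r + lhs y r).

Lemma carry0P c : c < B ^ R -> (c == carry0 I s) <-> reach 0 c.
Proof.
move=> hc; have hB : 0 < B by rewrite /cbase addn1.
have e0 : carry0 I s = \sum_(r < R) B ^ r * lhs S r.
  by rewrite /carry0 sumIE; apply: eq_bigr => r _; rewrite sumIE.
have hl r : lhs S r < B.
  rewrite /cbase addn1 ltnS (leq_trans (@lhs_le _ 2 r _)) //; last by rewrite mulnC.
  by move=> U _; rewrite -ltnS dig_lt.
split=> [/eqP ->|[y [h1 [h2 h3]]]].
  exists (fun=> 0); split=> [U _|]; first (by rewrite expn0); split=> // r hr; rewrite expn0 modn1 addn0 mul1n e0 dig_sum //.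
  by rewrite [X in _ + X]big1 ?addn0 // => U _; rewrite muln0.
apply/eqP/(eq_digits hc); first by rewrite e0 digits_lt.
move=> r hr; rewrite e0 dig_sum //; move: (h3 r hr).
rewrite expn0 modn1 addn0 mul1n => ->; rewrite [lhs y r]/lhs big1 ?addn0 // => U _.
by move: (h1 U (ltn_ord U)); rewrite expn0 ltnS leqn0 => /eqP ->; rewrite muln0.
Qed.

Lemma carry_okP k c c' y : carry_ok I s N1 N2 k c' c y <->
  (forall U, U < T -> dig 2 y U = 1 -> S U = 2) /\
  (forall r, r < R -> 2 * dig B c' r + b r %/ 2 ^ k %% 2 = dig B c r + lhs (dig 2 y) r).
Proof.
split.
  case/andP => /allbP h1 /allbP h2; split=> [U /h1 /implyP h /eqP /h /eqP //|r /h2 /eqP].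
  by rewrite shiftrE sumIE.
move=> [h1 h2]; apply/andP; split; apply/allbP => U hU.
  by apply/implyP => /eqP /(h1 _ hU) ->.
by rewrite shiftrE sumIE h2.
Qed.

(** An excess of [k + 1] bits splits into its low [k] bits, which explain a carry at stage [k], and
    its top bits, which form the code tried by the transition. *)
Lemma reachS k c' : c' < B ^ R -> reach k.+1 c' <-> exists2 c, c < B ^ R & reach k c /\
  exists2 y, y < 2 ^ T & carry_ok I s N1 N2 k c' c y.
Proof.
move=> hc'; have hB : 0 < B by rewrite /cbase addn1.
have h2k : 0 < 2 ^ k by rewrite expn_gt0.
split; last first.
  move=> [c hc [[y [h1 [h2 h3]]] [v hv /carry_okP [h4 h5]]]].
  exists (fun U => y U + 2 ^ k * dig 2 v U).
  have hd U : dig 2 v U < 2 by rewrite dig_lt.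
  split; last split.
  - move=> U hU; rewrite expnS; have := h1 _ hU; have := hd U; nia.
  - move=> U hU; case: (posnP (y U)) => [->|/(h2 _ hU) //] h.
    by apply: h4 => //; have := hd U; nia.
  - move=> r hr; rewrite lhsD lhsZ addnA -h3 // modn_exp2S expnS.
    have := h5 r hr; nia.
move=> [y [h1 [h2 h3]]].
pose y0 U := y U %% 2 ^ k; pose y1 U := y U %/ 2 ^ k.
have hy1 U : U < T -> y1 U < 2 by move=> hU; rewrite /y1 ltn_divLR // -expnS h1.
have hy U : y U = y0 U + 2 ^ k * y1 U by rewrite /y0 /y1 {1}(divn_eq (y U) (2 ^ k)) addnC mulnC.
have h3' r : r < R -> 2 ^ k * (2 * dig B c' r + b r %/ 2 ^ k %% 2) + b r %% 2 ^ k =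
    lhs S r + lhs y0 r + 2 ^ k * lhs y1 r.
  move=> hr; have e : lhs y r = lhs y0 r + 2 ^ k * lhs y1 r.
    by rewrite -lhsZ -lhsD; apply: eq_lhs => U _.
  rewrite -addnA -e.
  by rewrite -h3 // modn_exp2S expnS; nia.
(* The carry at stage [k] is forced. The subtraction is not truncated, because the low [k] bits of
   the right-hand side make less than [2 ^ k]. *)
pose d r := 2 * dig B c' r + b r %/ 2 ^ k %% 2 - lhs y1 r.
have hd r : r < R -> d r + lhs y1 r = 2 * dig B c' r + b r %/ 2 ^ k %% 2.
  move=> hr; rewrite /d subnK // -ltnS.
  have hm : b r %% 2 ^ k < 2 ^ k by rewrite ltn_pmod.
  have := h3' r hr; rewrite -(ltn_pmul2l h2k) mulnS; lia.
(* The origin of [cbase]: with [M = cods * (sg + 1)], the left-hand side is at most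
   [2 * M + (2 ^ k - 1) * M], hence at most [2 ^ k * (2 * M)]. *)
have hdB r : r < R -> d r < B.
  move=> hr; rewrite /cbase addn1 ltnS -(leq_pmul2l h2k).
  have := h3' r hr; rewrite -(hd r hr) mulnDr => h.
  have l1 : lhs S r <= T * (sg I + 1) * 2 by apply: lhs_le => U _; rewrite -ltnS dig_lt.
  have l2 : lhs y0 r <= T * (sg I + 1) * (2 ^ k - 1).
    by apply: lhs_le => U _; rewrite leq_subRL // add1n ltn_pmod.
  nia.
pose c := \sum_(r < R) B ^ r * d r.
have hc r : r < R -> dig B c r = d r by move=> hr; rewrite /c dig_sum.
exists c; first exact: digits_lt.
split.
  exists y0; split; last split.
  - by move=> U _; rewrite ltn_pmod.
  - by move=> U hU hU0; apply: h2 => //; rewrite hy addn_gt0 hU0.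
  - by move=> r hr; rewrite hc //; have := h3' r hr; rewrite -(hd r hr); nia.
pose v := \sum_(U < T) 2 ^ U * y1 U.
have hv U : U < T -> dig 2 v U = y1 U by move=> hU; rewrite /v dig_sum.
exists v; first exact: digits_lt.
apply/carry_okP; split.
  by move=> U hU; rewrite hv // => e; apply: h2 => //; rewrite hy e; nia.
by move=> r hr; rewrite hc // -hd //; congr (_ + _); apply: eq_lhs => U hU; rewrite hv.
Qed.

Lemma carriesP k c : c < B ^ R ->
  (dig 2 (iteri k (carry_next I s N1 N2) (2 ^ carry0 I s)) c == 1) <-> reach k c.
Proof.
elim: k c => [|k IH] c hc; first by rewrite /= dig_exp2 eqb1; apply: carry0P.
rewrite iteriS; move: (iteri _ _ _) IH => mask IH.
pose p c' := anyb (B ^ R) (fun c => (dig 2 mask c == 1) &&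
  anyb (2 ^ T) (carry_ok I s N1 N2 k c' c)).
rewrite /carry_next sumIE (@dig_mask _ p) // eqb1 reachS //; split.
  case/anybP => c1 hc1 /andP[/(IH _ hc1) h /anybP[y h1 h2]].
  by exists c1 => //; split=> //; exists y.
case=> c1 hc1 [/(IH _ hc1) h [y h1 h2]].
by apply/anybP; exists c1 => //; apply/andP; split=> //; apply/anybP; exists y.
Qed.

End Carries.

Lemma dig_0 B j : dig B 0 j = 0.
Proof. by rewrite /dig div0n mod0n. Qed.

Lemma csize_0 I : csize I 0 = 0.
Proof. by rewrite /csize sumIE big1 // => t _; rewrite /mult dig_0. Qed.

Lemma coef_0 I r : coef I r 0 = 0.
Proof. by rewrite /coef csize_0 /mult dig_0; case: ifP => // _; case: ifP. Qed.

Lemma supply_le I t : supply I t <= nn I.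
Proof.
by rewrite /supply -[X in _ <= X]muln1; apply: sumI_leM => i _; apply: leq_b1.
Qed.

Lemma rhs_le I N1 N2 r : N1 <= nn I -> N2 <= nn I -> rhs I N1 N2 r <= nn I.
Proof. by move=> h1 h2; rewrite /rhs; case: ifP => _; [apply: supply_le|case: ifP]. Qed.

Definition stable_mult ind I (z : nat -> nat) := 0 < z 0 /\
  forall U, U < cods I -> 0 < z U -> csize I U <= sg I /\
  forall V, V < cods I -> 0 < z V -> U != V \/ 1 < z U ->
  forall t, t < types I -> 0 < mult I U t -> ~~ deviates ind I t U V.

(** Stability asks of a multiplicity only whether it is positive and whether it exceeds 1; both
    survive capping at 2. *)
Lemma stable_supportP ind I s z :
  (forall U, U < cods I -> dig 3 s U = minn (z U) 2) ->
  stable_support ind I s <-> stable_mult ind I z.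
Proof.
move=> hz.
have c0 : 0 < cods I by rewrite expn_gt0 addn1.
have hz0 U : U < cods I -> (0 < dig 3 s U) = (0 < z U) by move/hz ->; lia.
have hz2 U : U < cods I -> (dig 3 s U == 2) = (1 < z U) by move/hz ->; lia.
rewrite /stable_support /stable_mult hz0 //; split.
  move=> /andP[-> /allbP h]; split=> // U hU hzU.
  have := h U hU; rewrite hz0 // hzU => /andP[-> /allbP h']; split=> // V hV hzV hUV t ht hm.
  have := h' V hV; rewrite hz0 // hzV hz2 //= implybE.
  have -> : (U != V) || (1 < z U) by apply/orP.
  by move=> /allbP/(_ t ht)/implyP; apply.
move=> [-> h]; apply/allbP => U hU; rewrite hz0 //; apply/implyP => hzU.
have [-> h'] := h U hU hzU; apply/allbP => V hV; rewrite hz0 // hz2 //.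
apply/implyP => /andP[hzV hUV]; apply/allbP => t ht; apply/implyP => hm.
by apply: h' => //; apply/orP.
Qed.

Lemma decide_hdgP ind I : decide_hdg ind I <-> exists z N1 N2,
  [/\ N1 <= minn (rh1 I) (nn I), N2 <= minn (rh2 I) (nn I), stable_mult ind I z &
   forall r, r < rows I -> lhs I z r = rhs I N1 N2 r].
Proof.
have c0 : 0 < cods I by rewrite expn_gt0 addn1.
have hB : 0 < cbase I ^ rows I by rewrite expn_gt0 /cbase addn1.
have hexp : nn I < 2 ^ (nn I + 1).
  by apply: ltn_trans (ltn_expl _ (ltnSn 1)) _; rewrite ltn_exp2l // addn1.
split.
  case/anybP => N1; rewrite addn1 ltnS => h1 /anybP[N2]; rewrite addn1 ltnS => h2.
  case/anybP => s hs /andP[hst].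
  have h1n : N1 <= nn I by apply: leq_trans h1 (geq_minr _ _).
  have h2n : N2 <= nn I by apply: leq_trans h2 (geq_minr _ _).
  case/(carriesP s h1n h2n _ hB) => y [hy [hy2 hyr]].
  exists (fun U => dig 3 s U + y U), N1, N2; split=> //.
    apply/(@stable_supportP ind I s) => // U hU.
    have hd : dig 3 s U < 3 by rewrite dig_lt.
    by case: (posnP (y U)) => [->|/(hy2 U hU) ->]; lia.
  move=> r hr; rewrite lhsD -hyr // dig_0 muln0 modn_small //.
  by apply: leq_ltn_trans hexp; apply: rhs_le.
move=> [z [N1 [N2 [h1 h2 hst hr]]]].
have h1n : N1 <= nn I by apply: leq_trans h1 (geq_minr _ _).
have h2n : N2 <= nn I by apply: leq_trans h2 (geq_minr _ _).
pose s := \sum_(U < cods I) 3 ^ U * minn (z U) 2.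
have hm U : U < cods I -> minn (z U) 2 < 3 by lia.
have hs U : U < cods I -> dig 3 s U = minn (z U) 2.
  by move=> hU; rewrite /s (dig_sum (d := fun U => minn (z U) 2)) // => i _; lia.
apply/anybP; exists N1; first by rewrite addn1.
apply/anybP; exists N2; first by rewrite addn1.
apply/anybP; exists s; first exact: (@digits_lt 3 _ (fun U => minn (z U) 2)).
apply/andP; split; first by apply/(@stable_supportP ind I s z hs).
apply/(carriesP s h1n h2n _ hB).
(* The system does not control the multiplicity of the empty coalition, so its excess is dropped,
   its column being zero. The others are at most [N1] by the row that counts nonempty coalitions. *)
exists (fun U => if U == 0 then 0 else z U - dig 3 s U); split; last split.
- move=> U hU; case: eqP => [_|/eqP U0]; first by rewrite expn_gt0.
  apply: leq_ltn_trans hexp; apply: leq_trans (leq_subr _ _) _; apply: leq_trans h1n.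
  have ht : types I < rows I by rewrite /rows; lia.
  have := hr _ ht; rewrite /rhs ltnn eqxx => <-.
  rewrite /lhs (bigD1 (Ordinal hU)) //= /coef ltnn eqxx U0 mul1n; exact: leq_addr.
- by move=> U hU; case: eqP => // _; rewrite hs //; lia.
- move=> r hrr; rewrite dig_0 muln0 modn_small; last first.
    by apply: leq_ltn_trans hexp; apply: rhs_le.
  rewrite add0n -hr // -lhsD; apply: eq_bigr => -[U hU] _ /=.
  case: ifP => [/eqP ->|_]; first by rewrite coef_0.
  by rewrite hs //; congr (_ * _); lia.
Qed.

(** * Palettes, types and coalition codes *)

Lemma card_sum (T : finType) (P : pred T) : #|[set x | P x]| = \sum_(x : T) P x.
Proof. by rewrite -sum1_card big_mkcond /=; apply: eq_bigr => x _; rewrite inE; case: (P x). Qed.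

(** This counts the agents of one colour taken by [sample]: the first [m] of them, or all if there
    are fewer. *)
Lemma sum_first n (p : nat -> bool) m :
  \sum_(a < n) (p a && (\sum_(a' < a) p a' < m)) = minn m (\sum_(a < n) p a).
Proof.
elim: n => [|n IH]; first by rewrite !big_ord0 minn0.
by rewrite !big_ord_recr /= IH; case: (p n) => /=; rewrite ?addn0 //; case: ltnP; lia.
Qed.

(** In a type the colour sits above the truth table, hence leaves its bits intact. *)
Lemma dig2_high q M S x : x < M -> dig 2 (q * 2 ^ M + S) x = dig 2 S x.
Proof.
move=> hx; rewrite /dig -(subnK hx) addnS -addSn expnD mulnA divnMDl ?expn_gt0 //.
by rewrite expnS mulnCA mulnC modnMDl.
Qed.

Section Game.
Variables (n gam : nat) (col : 'I_n -> 'I_gam) (pref : 'I_n -> rel (palette_t gam)).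
Variables (sigma rho1 rho2 : nat).
Local Notation I := (game_inst col pref sigma rho1 rho2).
Implicit Types (X Y C : {set 'I_n}) (i j : 'I_n).

Definition ccount X c := #|[set x in X | col x == c]|.

Lemma card_ccount X : #|X| = \sum_c ccount X c.
Proof.
rewrite -sum1_card (partition_big col predT) //=; apply: eq_bigr => c _.
by rewrite /ccount -sum1_card; apply: eq_bigl => x; rewrite inE.
Qed.

Lemma palette_eq X Y : (forall c, ccount X c = ccount Y c) -> palette col X = palette col Y.
Proof.
move=> h; have e : #|X| = #|Y| by rewrite !card_ccount; apply: eq_bigr.
by apply/ffunP => c; rewrite !ffunE -/(ccount X c) -/(ccount Y c) h e.
Qed.

(** Colour counts are coded instead of the fractions that they determine; for at most [sigma + 1]
    agents they can be read back as digits. *)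
Definition pcode X := \sum_(x in X) (sigma + 2) ^ col x.

Lemma pcodeE X : pcode X = \sum_(c < gam) (sigma + 2) ^ c * ccount X c.
Proof.
rewrite /pcode (partition_big col predT) //=; apply: eq_bigr => c _.
rewrite mulnC -sum_nat_const; under [RHS]eq_bigl => x do rewrite inE.
by apply: eq_bigr => x /andP[_ /eqP ->].
Qed.

Lemma ccount_le X c : ccount X c <= #|X|.
Proof. by apply: subset_leq_card; apply/subsetP => x; rewrite inE => /andP[]. Qed.

Lemma dig_pcode X (c : 'I_gam) : #|X| <= sigma.+1 -> dig (sigma + 2) (pcode X) c = ccount X c.
Proof.
move=> hX; have := @dig_sum (sigma + 2) gam
  (fun c => if insub c is Some c' then ccount X c' else 0) c.
rewrite valK; under eq_bigr => c' _ do rewrite valK.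
rewrite -pcodeE; apply=> // c' _.
by case: insub => [c''|]; rewrite addn2 ?ltnS ?(leq_trans (ccount_le _ _)).
Qed.

Lemma pcode_lt X : #|X| <= sigma.+1 -> pcode X < dcodes I.
Proof.
move=> hX; have := @digits_lt (sigma + 2) gam
  (fun c => if insub c is Some c' then ccount X c' else 0).
under eq_bigr => c' _ do rewrite valK.
rewrite -pcodeE; apply=> [|c' _]; first by rewrite addn2.
by case: insub => [c''|]; rewrite addn2 ?ltnS ?(leq_trans (ccount_le _ _)).
Qed.

Lemma rankE i : rank I i = \sum_(a < i) (col_nat col a == col_nat col i).
Proof.
rewrite /rank sumIE /= (big_ord_widen n (fun a => (col_nat col a == col_nat col i) : nat)).
  by rewrite [RHS]big_mkcond /=; apply: eq_bigr => a _; case: (a < i).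
exact: ltnW.
Qed.

(** [X] itself shows that enough agents of each colour exist, so the sample never falls short. *)
Lemma card_sample X c : #|X| <= sigma.+1 ->
  ccount [set a : 'I_n | sample I (pcode X) a] c = ccount X c.
Proof.
move=> hX; rewrite /ccount.
have -> : [set x in [set a : 'I_n | sample I (pcode X) a] | col x == c] =
    [set x : 'I_n | (col_nat col x == c) &&
       (\sum_(a < x) (col_nat col a == c) < ccount X c)].
  apply/setP => x; rewrite !inE andbC col_nat_ord.
  rewrite -[val (col x) == val c]/(col x == c); case: eqP => //= <-.
  by rewrite /sample /= rankE col_nat_ord dig_pcode.
rewrite [LHS]card_sum -[RHS]/(ccount X c); apply: etrans (sum_first n (fun x => col_nat col x == c) _) _.
apply/minn_idPl.
rewrite /ccount -(card_sum (fun x : 'I_n => col_nat col x == c)).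
by apply: subset_leq_card; apply/subsetP => x; rewrite !inE col_nat_ord => /andP[_ /eqP ->].
Qed.

Lemma set_of_sample d :
  Defs.set_of n (mkseq (fun a => if sample I d a then a else n) n) = [set a : 'I_n | sample I d a].
Proof.
apply/setP => x; rewrite !inE; apply/mapP/idP => [[j]|hx].
  rewrite mem_iota add0n => /= hj; case: ifP => [hs e|_ e]; first by rewrite [nat_of_ord x]e.
  by have := ltn_ord x; rewrite e ltnn.
by exists (nat_of_ord x); rewrite ?mem_iota /= ?ltn_ord ?hx.
Qed.

(** Sample and set have the same colour counts, hence the same palette, and the oracle sees nothing
    else. *)
Lemma asksE i X Y : #|X| <= sigma.+1 -> #|Y| <= sigma.+1 ->
  asks I i (pcode X) (pcode Y) = weakly_pref col pref i X Y.
Proof.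
move=> hX hY; rewrite /asks /= /game_oracle valK !set_of_sample /weakly_pref.
by congr (pref i _ _); apply: palette_eq => c; apply: card_sample.
Qed.

Lemma table_lt i : sumI (dcodes I * dcodes I)
  (fun x => 2 ^ x * asks I i (x %/ dcodes I) (x %% dcodes I)) < tables I.
Proof.
rewrite sumIE; apply: (@digits_lt 2 _ (fun x => asks I i (x %/ dcodes I) (x %% dcodes I) : nat)) => //.
by move=> x _; case: asks.
Qed.

Lemma typ_lt i : typ I i < types I.
Proof.
rewrite /typ /types /= col_nat_ord; have h := ltn_ord (col i).
apply: leq_trans (_ : (col i).+1 * tables I <= _); last by rewrite leq_mul2r h orbT.
by rewrite mulSn addnC ltn_add2r table_lt.
Qed.

Lemma weight_typ i : weight I (typ I i) = (sigma + 2) ^ col i.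
Proof.
rewrite /weight /typ divnMDl ?expn_gt0 // divn_small ?table_lt // addn0.
by rewrite /= col_nat_ord.
Qed.

Lemma prefersE i X Y : #|X| <= sigma.+1 -> #|Y| <= sigma.+1 ->
  prefers I (typ I i) (pcode X) (pcode Y) = weakly_pref col pref i X Y.
Proof.
move=> hX hY; have lX := pcode_lt hX; have lY := pcode_lt hY.
have lXY : pcode X * dcodes I + pcode Y < dcodes I * dcodes I.
  by apply: leq_trans (_ : (pcode X).+1 * dcodes I <= _); [rewrite mulSn addnC ltn_add2r|rewrite leq_mul2r lX orbT].
rewrite /prefers /typ dig2_high // sumIE.
rewrite (@dig_mask _ (fun x => asks I i (x %/ dcodes I) (x %% dcodes I))) // eqb1.
rewrite divnMDl; last exact: leq_ltn_trans lY.
by rewrite divn_small // addn0 modnMDl modn_small // asksE.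
Qed.

Definition tcount X t := #|[set x in X | typ I x == t]|.

Lemma sum_by_type X (F : nat -> nat) :
  \sum_(x in X) F (typ I x) = \sum_(t < types I) tcount X t * F t.
Proof.
rewrite (partition_big (fun x => Ordinal (typ_lt x)) predT) //=; apply: eq_bigr => t _.
rewrite /tcount -sum_nat_const; under [RHS]eq_bigl => x do rewrite inE.
by apply: eq_big => [x|x /andP[_ /eqP <-]].
Qed.

Definition code X := \sum_(t < types I) (sigma + 1) ^ t * tcount X t.

Lemma tcount_le X t : tcount X t <= #|X|.
Proof. by apply: subset_leq_card; apply/subsetP => x; rewrite inE => /andP[]. Qed.

Lemma code_lt X : #|X| <= sigma -> code X < cods I.
Proof.
move=> hX; apply: digits_lt => [|t _]; first by rewrite addn1.
by rewrite addn1 ltnS (leq_trans (tcount_le _ _)).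
Qed.

Lemma mult_code X t : #|X| <= sigma -> t < types I -> mult I (code X) t = tcount X t.
Proof.
move=> hX ht; apply: dig_sum => // t' _.
by rewrite addn1 ltnS (leq_trans (tcount_le _ _)).
Qed.

Lemma csize_code X : #|X| <= sigma -> csize I (code X) = #|X|.
Proof.
move=> hX; rewrite /csize sumIE -sum1_card (sum_by_type X (fun=> 1)).
by apply: eq_bigr => t _; rewrite muln1 mult_code.
Qed.

Lemma pal_code X : #|X| <= sigma -> pal I (code X) = pcode X.
Proof.
move=> hX; rewrite /pal sumIE /pcode.
under [RHS]eq_bigr => x _ do rewrite -weight_typ.
by rewrite sum_by_type; apply: eq_bigr => t _; rewrite mult_code.
Qed.

Lemma pcodeU1 C i : i \notin C -> pcode (C :|: [set i]) = pcode C + weight I (typ I i).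
Proof.
move=> hi; rewrite /pcode setUC (big_setD1 i) ?inE ?eqxx //= weight_typ addnC; congr (_ + _).
by apply: eq_bigl => x; rewrite !inE; case: eqP => // ->; rewrite (negPf hi).
Qed.

Lemma deviatesE ind i C X : i \notin C -> #|C| <= sigma -> #|X| <= sigma ->
  deviates ind I (typ I i) (code X) (code C) <->
  strictly_pref col pref i (C :|: [set i]) X /\
  (ind -> forall j, j \in C -> weakly_pref col pref j (C :|: [set i]) C).
Proof.
move=> hi hC hX; have hCi : #|C :|: [set i]| <= sigma.+1.
  by rewrite setUC cardsU1 hi add1n ltnS.
rewrite /deviates !pal_code // -pcodeU1 //.
have hX1 := leqW hX; have hC1 := leqW hC.
rewrite !prefersE // /strictly_pref; split.
  case/and3P => -> -> /implyP h; split=> // /h /allbP {}h j hj.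
  have ht := typ_lt j; have := h _ ht; rewrite mult_code // prefersE // => /implyP; apply.
  by rewrite card_gt0; apply/set0Pn; exists j; rewrite inE hj eqxx.
case=> /andP[-> ->] h /=; apply/implyP => /h {}h; apply/allbP => t ht.
rewrite mult_code //; apply/implyP; rewrite card_gt0 => /set0Pn[j]; rewrite inE => /andP[hj /eqP <-].
by rewrite prefersE // h.
Qed.

End Game.

Lemma csize_gt0 I U : U < cods I -> U != 0 -> 0 < csize I U.
Proof.
move=> hU; rewrite !lt0n; apply: contraNN => /eqP h; apply/eqP.
apply: (eq_digits hU); first by rewrite expn_gt0 addn1.
move=> t ht; rewrite dig_0; move: h; rewrite /csize sumIE.
by move/eqP; rewrite sum_nat_eq0 => /forallP/(_ (Ordinal ht))/eqP.
Qed.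

Lemma multiset_of_counts T (z : nat -> nat) : exists js : seq nat,
  (forall U, count_mem U js = if U < T then z U else 0) /\
  (forall F : nat -> nat, \sum_(U <- js) F U = \sum_(U < T) F U * z U).
Proof.
elim: T => [|T [js [h1 h2]]]; first by exists [::]; split=> // F; rewrite big_nil big_ord0.
exists (js ++ nseq (z T) T); split=> [U|F].
  rewrite count_cat h1 count_nseq /=; case: (ltngtP U T) => [h|h|->].
  - by rewrite (leqW h) addn0.
  - by rewrite ltnS leqNgt h.
  - by rewrite ltnSn mul1n.
rewrite big_cat h2 big_ord_recr /=; congr (_ + _).
by rewrite big_nseq iter_addn_0.
Qed.

(** * Outcomes as solutions of the linear system *)

Section Partitions.
Variables (n gam : nat) (col : 'I_n -> 'I_gam) (pref : 'I_n -> rel (palette_t gam)).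
Variables (sigma rho1 rho2 : nat).
Local Notation I := (game_inst col pref sigma rho1 rho2).
Local Notation code := (code col pref sigma rho1 rho2).
Local Notation tmem := (tcount col pref sigma rho1 rho2).
Implicit Types (X Y C : {set 'I_n}) (Pi : {set {set 'I_n}}).

Definition blocks Pi U := #|[set X in Pi | code X == U]|.

Lemma tcount_sum X t : tmem X t = \sum_(x in X) (typ I x == t).
Proof.
rewrite /tcount card_sum big_mkcond [RHS]big_mkcond; apply: eq_bigr => x _ /=.
by case: (x \in X).
Qed.

Lemma code_eq0 X : #|X| <= sigma -> (code X == 0) = (X == set0).
Proof.
move=> hX; apply/eqP/eqP => [h|->].
  by apply/eqP; rewrite -cards_eq0 -(csize_code col pref rho1 rho2 hX) h csize_0.
by rewrite /code big1 // => t _; rewrite tcount_sum big_set0 muln0.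
Qed.

(** Grouping the blocks by code and exchanging the sums turns each row into a sum over the
    partition. *)
Lemma lhs_blocks Pi r : partition Pi [set: 'I_n] -> (forall X, X \in Pi -> #|X| <= sigma) ->
  r < rows I ->
  lhs I (blocks Pi) r = rhs I #|Pi| #|[set C in Pi | 2 <= #|C|]| r.
Proof.
move=> hp hs hr.
have -> : lhs I (blocks Pi) r = \sum_(X in Pi) coef I r (code X).
  transitivity (\sum_(U < cods I) \sum_(X in Pi | code X == U) coef I r (code X)).
    apply: eq_bigr => U _; rewrite mulnC -sum_nat_const.
    under eq_bigl => X do rewrite inE.
    by apply: eq_bigr => X /andP[_ /eqP ->].
  rewrite [LHS](exchange_big_dep (mem Pi)) /=; last by move=> U X _ /andP[].
  apply: eq_bigr => X hX; rewrite (big_pred1 (Ordinal (code_lt col pref rho1 rho2 (hs X hX)))) //.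
  by move=> U /=; rewrite hX -val_eqE /= eq_sym.
rewrite /coef /rhs; case: ifP => [ht|_].
  transitivity (tmem setT r).
    rewrite tcount_sum (set_partition_big _ hp) /=; apply: eq_bigr => X hX.
    by rewrite mult_code ?hs // tcount_sum.
  rewrite tcount_sum /supply sumIE /=; apply: eq_bigl => x; exact: in_setT.
case: ifP => _.
  rewrite -sum1_card; apply: eq_bigr => X hX; rewrite code_eq0 ?hs //.
  by case: eqP hX => // ->; case/and3P: hp => _ _ /negPf ->.
rewrite card_sum big_mkcond; apply: eq_bigr => X _.
by case: ifP => //= hX; rewrite csize_code ?hs.
Qed.

Lemma exists_block (X : {set 'I_n}) U : U < cods I ->
  (forall t, t < types I -> mult I U t <= tmem X t) ->
  exists2 Y : {set 'I_n}, Y \subset X & (forall t, t < types I -> tmem Y t = mult I U t).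
Proof.
move=> hU h.
pose A t := [set x in take (mult I U t) (enum [set x in X | typ I x == t])].
exists [set x in X | x \in A (typ I x)]; first by apply/subsetP => x; rewrite inE => /andP[].
move=> t ht; have -> : mult I U t = #|A t|.
  rewrite cardsE /= (card_uniqP _) ?take_uniq ?enum_uniq // size_take -cardE.
  by have := h t ht; rewrite /tcount; case: ltngtP => //; lia.
apply: eq_card => x; rewrite !inE; case: (typ I x =P t) => [->|hx]; rewrite ?andbT ?andbF.
  case: (boolP (x \in take _ _)) => hx; rewrite ?andbF ?andbT //.
  by move: (mem_take hx); rewrite mem_enum inE => /andP[].
by apply/esym/negP => /mem_take; rewrite mem_enum inE => /andP[_ /eqP].
Qed.

Lemma code_of_mult X U : U < cods I -> (forall t, t < types I -> tmem X t = mult I U t) ->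
  code X = U /\ #|X| = csize I U.
Proof.
move=> hU h; split.
  by rewrite (digits_dig hU); apply: eq_bigr => t _; rewrite h.
rewrite -sum1_card (sum_by_type col pref sigma rho1 rho2 X (fun=> 1)) /csize sumIE.
by apply: eq_bigr => t _; rewrite muln1 h.
Qed.

(** Agents of one type are interchangeable, so a block for the first code may be carved out
    arbitrarily: the remaining demand still equals the remaining supply in every type, and at the
    end nobody is left. *)
Lemma build_partition (js : seq nat) X :
  (forall U, U \in js -> U < cods I /\ 0 < csize I U <= sigma) ->
  (forall t, t < types I -> \sum_(U <- js) mult I U t = tmem X t) ->
  exists Pi, [/\ partition Pi X, forall Y, Y \in Pi -> #|Y| <= sigma &
    forall U, blocks Pi U = count_mem U js].
Proof.
elim: js X => [|U js IH] X hjs hX.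
  have -> : X = set0.
    apply/setP => x; rewrite inE; apply/negP => hx.
    have := hX _ (typ_lt col pref sigma rho1 rho2 x); rewrite big_nil tcount_sum => /esym/eqP.
    by rewrite sum_nat_eq0 => /forallP/(_ x); rewrite hx eqxx.
  exists set0; split=> [|Y|U]; rewrite ?inE //.
    by apply/and3P; split; rewrite ?inE //; [rewrite /cover big_set0|apply/trivIsetP => ? ?; rewrite inE].
  by rewrite /blocks /=; apply/eqP; rewrite cards_eq0; apply/eqP/setP => Y; rewrite !inE.
have [hU /andP[hU0 hUs]] := hjs U (mem_head _ _).
have [|Y hYX hY] := @exists_block X U hU.
  by move=> t ht; rewrite -hX // big_cons leq_addr.
have [cY sY] := code_of_mult hU hY.
have hY0 : Y != set0 by rewrite -card_gt0 sY.
have [||Pi [hp hs hb]] := IH (X :\: Y).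
- by move=> V hV; apply: hjs; rewrite inE hV orbT.
- move=> t ht; have := hX t ht; rewrite big_cons !tcount_sum (big_setID Y) /= (setIidPr hYX).
  by rewrite -!tcount_sum hY //; lia.
have hYPi : Y \notin Pi.
  apply/negP => hYPi; case/set0Pn: hY0 => x hx; case/and3P: hp => /eqP cov _ _.
  have : x \in X :\: Y by rewrite -cov; apply/bigcupP; exists Y.
  by rewrite inE hx.
exists (Y |: Pi); split.
- rewrite (_ : X = Y :|: (X :\: Y)); last first.
    by apply/setP => x; rewrite !inE; case: (boolP (x \in Y)) => // /(subsetP hYX) ->.
  case/and3P: hp => /eqP cov triv n0; apply/and3P; split.
  + by rewrite /cover big_setU1 //= -/(cover Pi) cov.
  + apply/trivIsetP => A B; rewrite !inE => /orP[/eqP->|hA] /orP[/eqP->|hB]; first by rewrite eqxx.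
    * move=> _; rewrite disjoints_subset; apply/subsetP => x hx; rewrite inE; apply/negP => hxB.
      have : x \in X :\: Y by rewrite -cov; apply/bigcupP; exists B.
      by rewrite inE hx.
    * move=> _; rewrite disjoints_subset; apply/subsetP => x hxA; rewrite inE; apply/negP => hx.
      have : x \in X :\: Y by rewrite -cov; apply/bigcupP; exists A.
      by rewrite inE hx.
    * by move/trivIsetP: triv; apply.
  + by rewrite !inE negb_or eq_sym hY0.
- by move=> Z; rewrite !inE => /orP[/eqP ->|/hs//]; rewrite sY.
- move=> V; rewrite /= -hb /blocks.
  case: (eqVneq U V) => [<-|hUV].
    rewrite (_ : [set Z in _ | _] = Y |: [set Z in Pi | code Z == U]); last first.
      by apply/setP => Z; rewrite !inE; case: eqP => [->|]; rewrite ?cY ?eqxx.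
    by rewrite cardsU1 inE (negPf hYPi).
  rewrite add0n; apply: eq_card => Z; rewrite !inE.
  by case: (Z =P Y) => [->|//]; rewrite cY (negPf hUV) !andbF.
Qed.

End Partitions.

(** Treats both stability notions at once; the flag has the same role as in [deviates]. *)
Definition deviation_free (ind : bool) : stability_notion := fun n gam col pref Pi =>
  forall (i : 'I_n) C, ~ (NS_deviation col pref Pi i C /\
    (ind -> forall j, j \in C -> weakly_pref col pref j (C :|: [set i]) C)).

Section Correctness.
Variables (ind : bool) (n gam : nat) (col : 'I_n -> 'I_gam) (pref : 'I_n -> rel (palette_t gam)).
Variables (sigma rho1 rho2 : nat).
Local Notation I := (game_inst col pref sigma rho1 rho2).

Lemma decide_hdg_correct :
  decide_hdg ind I <-> hdg_yes (deviation_free ind) col pref sigma rho1 rho2.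
Proof.
(* The column of the empty coalition is zero, so its multiplicity is free. *)
have hlhs z z' r : (forall U, U < cods I -> U != 0 -> z U = z' U) -> lhs I z r = lhs I z' r.
  move=> h; apply: eq_bigr => -[U hU] _ /=.
  by case: (eqVneq U 0) => [->|hU0]; rewrite ?coef_0 // h.
have hT : types I < rows I by rewrite /rows; lia.
have hT1 : (types I).+1 < rows I by rewrite /rows; lia.
have rT N1 N2 : rhs I N1 N2 (types I) = N1 by rewrite /rhs ltnn eqxx.
have rT1 N1 N2 : rhs I N1 N2 (types I).+1 = N2 by rewrite /rhs ltnNge leqnSn /= gtn_eqF.
rewrite decide_hdgP; split.
  move=> [z [N1 [N2 [h1 h2 [hz0 hst] hr]]]].
  have [js [hjs1 hjs2]] := multiset_of_counts (cods I) (fun U => if U == 0 then 0 else z U).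
  have hjs U : U \in js -> U < cods I /\ 0 < z U.
    by rewrite -has_pred1 has_count hjs1; case: ifP => // hU; case: ifP.
  have [||Pi [hp hs hb]] := @build_partition _ _ col pref sigma rho1 rho2 js setT.
  - move=> U hU; have [hU1 hU2] := hjs U hU; split=> //.
    have [-> _] := hst U hU1 hU2; rewrite andbT; apply: csize_gt0 => //.
    by apply: contraTneq hU => ->; rewrite -has_pred1 has_count hjs1 /=; case: ifP.
  - move=> t ht; rewrite hjs2.
    have ht' : t < rows I by rewrite /rows; lia.
    transitivity (lhs I z t).
      rewrite (@hlhs _ (fun U => if U == 0 then 0 else z U)); last by move=> U _ /negPf ->.
      by apply: eq_bigr => U _; rewrite /coef ht.
    rewrite hr // /rhs ht /supply sumIE tcount_sum /=.
    by apply: eq_bigl => x; rewrite in_setT.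
  have hbz U : U < cods I -> U != 0 -> blocks col pref sigma rho1 rho2 Pi U = z U.
    by move=> hU hU0; rewrite hb hjs1 hU (negPf hU0).
  have hl r (hrr : r < rows I) := lhs_blocks hp hs hrr.
  have e1 := hl _ hT; rewrite (hlhs _ _ _ hbz) hr // !rT in e1.
  have e2 := hl _ hT1; rewrite (hlhs _ _ _ hbz) hr // !rT1 in e2.
  exists Pi; split=> //; split; first by rewrite -e1 (leq_trans h1) ?geq_minl.
  split; first by rewrite -e2 (leq_trans h2) ?geq_minl.
  split=> // i C [[hC [hiC hpr]] hind].
  have hcov : cover Pi = setT by case/and3P: hp => /eqP.
  have hXPi : pblock Pi i \in Pi by rewrite pblock_mem // hcov.
  have hiX : i \in pblock Pi i by rewrite mem_pblock hcov.
  set X := pblock Pi i in hpr hXPi hiX.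
  have sX := hs _ hXPi.
  have sC : #|C| <= sigma by case: hC => [/hs //|->]; rewrite cards0.
  pose cd := code col pref sigma rho1 rho2.
  have zpos Y : Y \in Pi -> 0 < z (cd Y).
    move=> hY; have hYs := hs _ hY; rewrite -hbz ?code_lt //.
      by rewrite card_gt0; apply/set0Pn; exists Y; rewrite inE hY eqxx.
    by rewrite code_eq0 //; apply: contraTneq hY => ->; case/and3P: hp.
  have zC : 0 < z (cd C).
    by case: hC => [/zpos //|hC]; have -> : cd C = 0 by apply/eqP; rewrite /cd code_eq0 ?hC ?cards0.
  have [_ h] := hst (cd X) (code_lt _ _ _ _ sX) (zpos _ hXPi).
  have htw : 0 < mult I (cd X) (typ I i).
    rewrite mult_code ?typ_lt // card_gt0; apply/set0Pn; exists i.
    by rewrite inE hiX eqxx.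
  (* If the codes agree, [X] and [C] are nevertheless different blocks, as only [X] contains [i]; so
     the code occurs twice. *)
  have hne : cd X != cd C \/ 1 < z (cd X).
    case: (eqVneq (cd X) (cd C)) => [e|]; [right|by left].
    have hX0 : cd X != 0 by rewrite code_eq0 //; apply/set0Pn; exists i.
    have hCPi : C \in Pi by case: hC => // hC; move: hX0; rewrite e code_eq0 // hC eqxx.
    rewrite -hbz ?code_lt //; apply/card_gt1P; exists X, C; rewrite !inE hXPi hCPi eqxx e eqxx.
    by split=> //; apply: contraNneq hiC => <-.
  have := h (cd C) (code_lt _ _ _ _ sC) zC hne (typ I i) (typ_lt _ _ _ _ _ _) htw.
  by move/negP; apply; apply/(deviatesE _ _ _ _ _ hiC sC sX).
move=> [Pi [hp [h1 [h2 [hs hst]]]]].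
pose cd := code col pref sigma rho1 rho2.
(* The empty set is no block but a possible target, so code 0 is given a copy by hand. *)
pose z U := blocks col pref sigma rho1 rho2 Pi U + (U == 0).
have hn : #|Pi| <= n.
  rewrite -[X in _ <= X]card_ord -cardsT (card_partition hp) -sum1_card.
  by apply: leq_sum => X hX; rewrite card_gt0; apply: contraTneq hX => ->; case/and3P: hp.
exists z, #|Pi|, #|[set C in Pi | 2 <= #|C|]|; split.
- by rewrite leq_min h1.
- rewrite leq_min h2; apply: leq_trans hn; apply: subset_leq_card.
  by apply/subsetP => X; rewrite inE => /andP[].
- split; first by rewrite /z eqxx addn1.
  have inv U : 0 < z U -> U != 0 -> exists2 X, X \in Pi & cd X = U.
    move=> hz /negPf hU0; move: hz; rewrite /z hU0 addn0 card_gt0 => /set0Pn[X].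
    by rewrite inE => /andP[hX /eqP]; exists X.
  move=> U hU hzU; split.
    case: (eqVneq U 0) => [->|/(inv _ hzU)[X hX <-]]; first by rewrite csize_0.
    by rewrite csize_code ?hs.
  move=> V hV hzV hUV t ht htU.
  have hU0 : U != 0 by apply: contraTneq htU => ->; rewrite /mult dig_0.
  (* Two distinct sets realise the codes. When the codes coincide, multiplicity above 1 supplies two
     blocks. *)
  have [X [C [hX eX hC eC hXC]]] : exists X C, [/\ X \in Pi, cd X = U,
      C \in Pi \/ C = set0, cd C = V & X != C].
    have [X hX eX] := inv U hzU hU0.
    have hX0 : X != set0 by apply: contraTneq hX => ->; case/and3P: hp.
    case: (eqVneq V 0) => [->|hV0].
      by exists X, set0; split=> //; [right|apply/eqP; rewrite code_eq0 ?cards0].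
    have [C hC eC] := inv V hzV hV0.
    case: (eqVneq U V) => [eUV|hne]; last first.
      by exists X, C; split=> //; [left|apply: contraNneq hne => e; rewrite -eX -eC e].
    case: hUV; first by rewrite eUV eqxx.
    rewrite /z (negPf hU0) addn0 => /card_gt1P[X1 [X2 []]]; rewrite !inE.
    move=> /andP[k1 /eqP k2] /andP[k3 /eqP k4] k5.
    by exists X1, X2; split=> //; [left|rewrite -eUV].
  have sX := hs _ hX.
  have sC : #|C| <= sigma by case: hC => [/hs //|->]; rewrite cards0.
  move: htU; rewrite -eX mult_code // card_gt0 => /set0Pn[i]; rewrite inE => /andP[hi /eqP <-].
  have htriv : trivIset Pi by case/and3P: hp.
  have hiC : i \notin C.
    case: hC => [hC|->]; last by rewrite inE.
    apply/negP => hiC; move/trivIsetP: htriv => /(_ _ _ hX hC hXC).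
    by rewrite disjoints_subset => /subsetP/(_ i hi); rewrite inE hiC.
  rewrite -eC; apply/negP => /(deviatesE _ _ _ _ _ hiC sC sX) [hpr hind].
  by apply: (hst i C); split=> //; split=> //; split=> //; rewrite (def_pblock htriv hX hi).
move=> r hr; rewrite -(lhs_blocks hp hs hr); apply: hlhs => U _ /negPf hU0.
by rewrite /z hU0 addn0.
Qed.

End Correctness.

Lemma fpt_deviation_free ind : fpt_gamma_sigma (deviation_free ind).
Proof.
apply: (@fpt_of_decision (deviation_free ind) ind); last by move=> gam col pref Pi [].
by move=> n gam col pref sigma rho1 rho2 _ _; apply: decide_hdg_correct.
Qed.

Lemma fpt_iff (s s' : stability_notion) :
  (forall n gam col pref Pi, s n gam col pref Pi <-> s' n gam col pref Pi) ->
  fpt_gamma_sigma s -> fpt_gamma_sigma s'.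
Proof.
move=> h [P [f [c [hf hP]]]]; exists P, f, c; split=> // n gam col pref sigma rho1 rho2 hv.
have [h1 h2] := hP n gam col pref sigma rho1 rho2 hv; split=> //; rewrite h2.
by split=> -[Pi [k1 [k2 [k3 [k4 k5]]]]]; exists Pi; do !split=> //; apply/h.
Qed.

Theorem theorem1 :
  fpt_gamma_sigma (@nash_stable) /\ fpt_gamma_sigma (@indiv_stable).
Proof.
split.
  apply: fpt_iff (fpt_deviation_free false) => n gam col pref Pi.
  by split=> h i C; [move=> hd|case=> hd _]; apply: (h i C).
apply: fpt_iff (fpt_deviation_free true) => n gam col pref Pi.
by split=> h i C [hd hj]; apply: (h i C); split=> //; exact: hj.
Qed.
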